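(* Let $n\ge2$, let $u_t=K(t,x,u,u_1,\dots,u_n)$ be a scalar evolution equation with $K$ smooth and $\partial K/\partial u_n$ nowhere zero, and let $\mathcal R^\infty$ be its equation manifold. Then $H^{1,s}(\mathcal R^\infty)=0$ for all $s\ge3$.
   Context: Write $u_0=u$, $u_i=\partial_x^i u$; smooth functions depend on finitely many coordinates. $\mathcal R^\infty$ is the infinitely prolonged equation manifold of $u_t=K$, with coordinates $(t,x,u,u_1,u_2,\dots)$. On it $X=\partial_x+\sum_i u_{i+1}\partial_{u_i}$, $T=\partial_t+\sum_i X^i(K)\partial_{u_i}$, $\theta^i=du_i-X^i(K)\,dt-u_{i+1}\,dx$. $\Omega^{r,s}(\mathcal R^\infty)$ is the space of forms that are finite sums of a function times $r$ of the forms $dt,dx$ wedged with $s$ of the $\theta^i$. $X$ and $T$ act on forms by Lie derivative (so they annihilate $dt,dx$ and $X(\theta^i)=\theta^{i+1}$). $d_H\omega=dx\wedge X(\omega)+dt\wedge T(\omega)$ and $H^{r,s}(\mathcal R^\infty)=\ker(d_H|_{\Omega^{r,s}})/d_H(\Omega^{r-1,s})$. *)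

(* Defs.v *)
From HB Require Import structures.
From mathcomp Require Import all_boot all_order all_algebra.
From mathcomp Require Import all_classical all_reals all_analysis.
Set Implicit Arguments.
Unset Strict Implicit.
Unset Printing Implicit Defensive.
Import Order.TTheory GRing.Theory Num.Theory.
Import numFieldNormedType.Exports.
Local Open Scope classical_set_scope.
Local Open Scope ring_scope.

(* Labels of the coordinates (t, x, u, u_1, u_2, ...); [cu i] is u_i. *)
Inductive jcoord := ct | cx | cu of nat.

Definition jcoord_code (c : jcoord) : option (option nat) :=
  match c with ct => None | cx => Some None | cu i => Some (Some i) end.
Definition jcoord_decode (o : option (option nat)) : jcoord :=
  match o with None => ct | Some None => cx | Some (Some i) => cu i end.
Lemma jcoord_codeK : cancel jcoord_code jcoord_decode.
Proof. by case. Qed.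
HB.instance Definition _ := Countable.copy jcoord (can_type jcoord_codeK).

(* The equation manifold in its global coordinates.  It carries the product
   topology; a function of finitely many coordinates is continuous for it iff
   it is continuous as a function of these coordinates. *)
Definition Rinfty (R : realType) := prod_topology (fun _ : jcoord => R).

(* Tangent vectors, given by their components on d/dt, d/dx, d/du_i; as the
   manifold is not finite-dimensional, infinitely many may be nonzero. *)
Definition tvec (R : realType) := jcoord -> R.

Section Forms.
Context {R : realType}.
Implicit Types (f K : Rinfty R -> R) (p q : Rinfty R).

Definition slice f p (c : jcoord) : R -> R := fun y => f (dfwith p c y).

Definition pd (c : jcoord) f : Rinfty R -> R :=
  fun p => derive1 (slice f p c) (p c).

Definition depends_upto (n : nat) f :=
  forall p q, p ct = q ct -> p cx = q cx ->
    (forall i, (i <= n)%N -> p (cu i) = q (cu i)) -> f p = f q.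

Definition smooth f :=
  (exists n, depends_upto n f) /\
  forall l : seq jcoord, let g := foldr pd f l in
    continuous g /\ forall c p, derivable (slice g p c) (p c) 1.

(* The sum has finite support when [f] depends on finitely many coordinates. *)
Definition dirD (v : tvec R) f : Rinfty R -> R :=
  fun p => \sum_(c \in [set: jcoord]) v c * pd c f p.

Definition vfield := Rinfty R -> tvec R.

Definition vfact (V : vfield) f : Rinfty R -> R := fun p => dirD (V p) f p.

Definition Xvf : vfield := fun p c =>
  match c with ct => 0 | cx => 1 | cu i => p (cu i.+1) end.

Definition Tvf K : vfield := fun p c =>
  match c with ct => 1 | cx => 0 | cu i => iter i (vfact Xvf) K p end.

Definition kform (k : nat) := Rinfty R -> ('I_k -> tvec R) -> R.

Definition oneform := Rinfty R -> tvec R -> R.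

Definition dcoord (c : jcoord) : oneform := fun _ v => v c.

Definition theta K (i : nat) : oneform := fun p v =>
  dcoord (cu i) p v - iter i (vfact Xvf) K p * dcoord ct p v
  - p (cu i.+1) * dcoord cx p v.

(* alpha_0 /\ ... /\ alpha_(k-1), normalised so that its value on
   (v_0, ..., v_(k-1)) is det (alpha_a (v_b)). *)
Definition wedge1s k (alpha : 'I_k -> oneform) : kform k :=
  fun p v => \det (\matrix_(a < k, b < k) alpha a p (v b)).

(* alpha /\ w, in the same normalisation. *)
Definition wedgel k (alpha : oneform) (w : kform k) : kform k.+1 :=
  fun p v => \sum_(a < k.+1)
    (-1) ^+ a * alpha p (v a) * w p (fun b => v (lift a b)).

(* Lie derivative: the usual formula
     (L_V w)(W_1, .., W_k) = V (w (W_1, .., W_k))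
                             - \sum_a w (W_1, .., [V, W_a], .., W_k)
   evaluated on constant-coefficient fields W_a = v a, for which
   [V, W_a] = - dirD (v a) V componentwise. *)
Definition lie (V : vfield) k (w : kform k) : kform k := fun p v =>
  vfact V (fun q => w q v) p +
  \sum_(a < k) w p (fun b =>
    if b == a then fun c => dirD (v a) (fun q => V q c) p else v b).

Definition dH K k (w : kform k) : kform k.+1 := fun p v =>
  wedgel (dcoord cx) (lie Xvf w) p v + wedgel (dcoord ct) (lie (Tvf K) w) p v.

(* The forms h_0 /\ .. /\ h_(r-1) /\ theta^(i_0) /\ .. /\ theta^(i_(s-1)), with
   each h_a equal to dt ([h a = true]) or dx ([h a = false]). *)
Definition basic K r s (h : 'I_r -> bool) (i : 'I_s -> nat) : kform (r + s) :=
  wedge1s (fun a => match fintype.split a with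
                  | inl b => dcoord (if h b then ct else cx)
                  | inr b => theta K (i b)
                  end).

Definition Omega K r s : set (kform (r + s)) := [set w |
  exists m (f : 'I_m -> Rinfty R -> R)
         (h : 'I_m -> 'I_r -> bool) (i : 'I_m -> 'I_s -> nat),
    (forall j, smooth (f j)) /\
    w = fun p v => \sum_(j < m) f j p * basic K (h j) (i j) p v].
Arguments Omega : clear implicits.

Definition cocycles K r s : set (kform (r + s)) :=
  [set w | Omega K r s w /\ dH K w = fun _ _ => 0].
Arguments cocycles : clear implicits.

Definition coboundaries K r s : set (kform (r + s)) :=
  match r return set (kform (r + s)) with
  | 0 => [set fun _ _ => 0]
  | r'.+1 => dH K (k := r' + s) @` Omega K r' s
  end.
Arguments coboundaries : clear implicits.

Definition coset K r s (w : kform (r + s)) : set (kform (r + s)) :=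
  [set (fun p v => w p v + c p v) | c in coboundaries K r s].

(* The quotient of cocycles by coboundaries, as the set of cosets. *)
Definition cohomology K r s : set (set (kform (r + s))) :=
  [set coset K w | w in cocycles K r s].
Arguments cohomology : clear implicits.

Definition cohomology_eq0 K r s :=
  cohomology K r s = [set coset K (fun _ _ => 0)].

End Forms.

(* Main.v *)
From HB Require Import structures.
Require Import Defs.
From mathcomp Require Import all_boot all_order all_fingroup all_algebra.
From mathcomp Require Import zify ring lra.
From mathcomp.multinomials Require mpoly.
Set Implicit Arguments.
Unset Strict Implicit.
Unset Printing Implicit Defensive.
Import Order.TTheory GRing.Theory Num.Theory.
Local Open Scope ring_scope.

(** A form of type (1,s) is w = dx /\ alpha + dt /\ beta with alpha, beta of type
    (0,s), and d_H w = 0 says X beta = T alpha, where X and T act by Lie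
    derivative.  A primitive of w is a form gamma of type (0,s) with
    X gamma = alpha and T gamma = beta.  Since [X, T] = 0 and X is injective on
    forms of type (0,s), the second equation follows from the first, because
    X (T gamma) = T alpha = X beta.  So everything rests on one implication:
    if T alpha is in the image of X, then so is alpha.

    Encode the coefficients of theta^(i_1) ... theta^(i_s) as those of a
    polynomial in z_1, ..., z_s, the monomial z^I standing for theta^I.  On the
    part of highest degree, X multiplies by z_1 + ... + z_s, and T multiplies by
    K_n (z_1^n + ... + z_s^n), where K_n = dK/du_n; everything else in X and T has
    lower degree.  If P is the leading part of alpha, then X beta = T alpha gives
    (z_1 + ... + z_s) Q = K_n (z_1^n + ... + z_s^n) P for a polynomial Q.  When
    s >= 3 and n >= 2 the power sum z_1^n + ... + z_s^n does not vanish on the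
    hyperplane z_1 + ... + z_s = 0: its value at (-2, 1, 1, 0, ..., 0) is
    (-2)^n + 2.  Hence z_1 + ... + z_s divides P ([psum_mul_divide]).  Subtracting
    X of the quotient lowers the degree of alpha ([peel_top]), and an induction
    on this degree ends at alpha = 0 ([vertical_poincare_deg]).  The same leading
    terms show that X is injective ([lieX_inj]).

    Forms of type (0,s) are handled as tensors, sums of
    f * theta^(i_1) (v_1) ... theta^(i_s) (v_s) ([vert]), whose coefficients form
    an arbitrary array.  Alternation commutes with X and T ([lie_alternate]), so a
    primitive can be made alternating afterwards.  That X and T commute as
    derivations ([lie_XT]) reduces to their action on functions and on the
    theta^i, and there to the symmetry of second partial derivatives ([pdC]),
    which follows from the mean value theorem applied to a second difference
    ([clairaut_plane]). *)

(** * Division by the first power sum *)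

(** Lie derivatives of forms replace one argument at a time; this is the
    expression used for that replacement, and serves for multi-indices as well. *)
Definition upd (A : Type) s (I : 'I_s -> A) (a : 'I_s) (x : A) : 'I_s -> A :=
  fun b => if b == a then x else I b.

Definition deg s (I : 'I_s -> nat) : nat := (\sum_a I a)%N.

(** Multiplication of a polynomial by z_1^n + ... + z_s^n, in terms of the
    coefficients [c I] of the monomials z^I. *)
Definition psum_mul (V : nmodType) s n (c : ('I_s -> nat) -> V) : ('I_s -> nat) -> V :=
  fun I => \sum_a if (n <= I a)%N then c (upd I a (I a - n)%N) else 0.

Lemma deg_upd s (I : 'I_s -> nat) a x : (deg (upd I a x) + I a = deg I + x)%N.
Proof.
rewrite /deg (bigD1 a) //= [in RHS](bigD1 a) //= /upd eqxx.
rewrite (eq_bigr I) => [|b /negbTE ->//]; lia.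
Qed.

Lemma deg_shift s (I : 'I_s -> nat) a n : (n <= I a)%N ->
  (deg (upd I a (I a - n)%N) + n = deg I)%N.
Proof. by move=> nI; have := deg_upd I a (I a - n); lia. Qed.

Module PowerSums.
Import mpoly.

Section Divide.
Variables (F : realFieldType) (s : nat).
Implicit Types (p q : {mpoly F[s]}) (c : ('I_s -> nat) -> F).

Definition power_sum n : {mpoly F[s]} := \sum_i 'X_i ^+ n.

(** The polynomial with coefficients [c]; the truncation at degree [m] makes the
    sum finite and is harmless as soon as [c] vanishes above [m]. *)
Definition poly_of m c : {mpoly F[s]} :=
  \sum_(J : 'X_{1..s < m.+1}) c (fun i => J i) *: 'X_[J].

Lemma mcoeff_poly_of m c : (forall I, (m < deg I)%N -> c I = 0) ->
  forall J : 'X_{1..s}, (poly_of m c)@_J = c (fun i => J i).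
Proof.
move=> cm J; have [Jm|mJ] := leqP (mdeg J) m.
  by rewrite (mcoeff_mpoly (fun J : 'X_{1..s} => c (fun i => J i))).
rewrite cm /deg -?mdegE // raddf_sum big1 //= => L _.
rewrite mcoeffZ mcoeffX; case: eqP => [LJ|_]; last by rewrite mulr0.
by have := bmdeg L; rewrite LJ ltnS leqNgt mJ.
Qed.

Lemma mcoeff_power_sum_mul n p J c : (forall J : 'X_{1..s}, p@_J = c (fun i => J i)) ->
  (power_sum n * p)@_J = psum_mul n c (fun i => J i).
Proof.
move=> pc; rewrite mulr_suml raddf_sum; apply: eq_bigr => a _ /=.
rewrite mpolyXn -commr_mpolyX; case: ifPn => [nJ|nJ].
  have leJ : (U_(a) *+ n <= J)%MM.
    apply/mnm_lepP => b; rewrite mulmnE mnm1E.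
    by case: eqP => [<-|_]; rewrite ?mul1n ?mul0n.
  rewrite -[in LHS](submK leJ) addmC mcoeffMX pc; congr c; apply: boolp.funext => b.
  rewrite mnmBE mulmnE mnm1E /upd eq_sym.
  by case: eqP => [->|_]; rewrite ?mul1n ?mul0n ?subn0.
apply: memN_msupp_eq0; rewrite (perm_mem (msuppMX _ _)).
apply: contra nJ => /mapP[L _ ->].
by rewrite mnmDE mulmnE mnm1E eqxx mul1n leq_addr.
Qed.

Lemma power_sum_poly_of m n k a b :
  (forall I, (m < deg I)%N -> a I = 0) ->
  (forall I, (m < deg I)%N -> b I = 0) ->
  (forall I, psum_mul 1 b I = k * psum_mul n a I) ->
  power_sum 1 * poly_of m b = k *: (power_sum n * poly_of m a).
Proof.
move=> am bm ba; apply/mpolyP => J.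
rewrite mcoeffZ (mcoeff_power_sum_mul _ _ (mcoeff_poly_of am)) //.
by rewrite (mcoeff_power_sum_mul _ _ (mcoeff_poly_of bm)).
Qed.

Hypothesis s3 : (2 < s)%N.

Let i0 : 'I_s := Ordinal (ltn_trans (isT : (0 < 2)%N) s3).
Let i1 : 'I_s := Ordinal (ltn_trans (isT : (1 < 2)%N) s3).
Let i2 : 'I_s := Ordinal s3.

(** Substituting minus the sum of the other variables for the variable [i0] is
    restriction to the hyperplane where all variables sum to zero. *)
Let elim0 : s.-tuple {mpoly F[s]} :=
  [tuple (if i == i0 then - \sum_(j | j != i0) 'X_j else 'X_i) | i < s].

(** A point of that hyperplane at which no higher power sum vanishes; it needs
    three coordinates. *)
Let pt (i : 'I_s) : F := if i == i0 then - 2 else if (i == i1) || (i == i2) then 1 else 0.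

Lemma power_sum1E : power_sum 1 = \sum_i 'X_i.
Proof. by apply: eq_bigr => i _; rewrite expr1. Qed.

Lemma meval_elim p : (p \mPo elim0).@[pt] = p.@[pt].
Proof.
rewrite comp_mpoly_meval; apply: meval_eq => i; rewrite tnth_mktuple.
case: eqP => [->|_]; last by rewrite mevalXU.
rewrite mevalN (big_morph _ (mevalD _) (meval0 _)) (bigD1 i1) //= (bigD1 i2) //= !mevalXU.
rewrite big1 => [|j /andP[/andP[/negbTE j0 /negbTE j1] /negbTE j2]].
  by rewrite /pt /= addr0.
by rewrite mevalXU /pt j0 j1 j2.
Qed.

(** The value at [pt] is 2 + (-2)^n.  It is positive for even n; for odd n it is
    2 - 2^n, which is negative because n > 1. *)
Lemma power_sum_elim_neq0 n : (1 < n)%N -> power_sum n \mPo elim0 != 0.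
Proof.
move=> n1; apply/eqP => /(congr1 (meval pt)); rewrite meval_elim meval0.
rewrite /power_sum (big_morph _ (mevalD _) (meval0 _)) (bigD1 i0) //=.
rewrite (bigD1 i1) //= (bigD1 i2) //=.
rewrite !rmorphXn /= !mevalXU big1 => [|j /andP[/andP[/negbTE j0 /negbTE j1] /negbTE j2]].
  rewrite /pt /= !expr1n addr0 => /eqP; apply/negP.
  rewrite exprNn -signr_odd; case: (odd n) => /=.
    have: (2 : F) ^+ 2 <= 2 ^+ n by rewrite ler_weXn2l // ler1n.
    rewrite expr1; lra.
  have : (0 : F) < 2 ^+ n by rewrite exprn_gt0.
  rewrite expr0; lra.
by rewrite rmorphXn /= mevalXU /pt j0 j1 j2 expr0n; case: n n1.
Qed.

(** The substitution is a ring morphism which moves each variable by a multiple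
    of the sum of all variables, hence moves every polynomial by such a
    multiple. *)
Lemma elim_congr p : exists q, p - (p \mPo elim0) = power_sum 1 * q.
Proof.
pose P p := exists q, p - (p \mPo elim0) = power_sum 1 * q.
have PM p1 p2 : P p1 -> P p2 -> P (p1 * p2).
  move=> [q1 e1] [q2 e2]; exists (q1 * p2 + (p1 \mPo elim0) * q2).
  rewrite rmorphM /= mulrDr mulrA -e1 [in X in _ = _ + X]mulrCA -e2; ring.
have P1 : P 1 by exists 0; rewrite comp_mpoly1 subrr mulr0.
elim/mpolyind: p => [|c m p _ _ [q IH]].
  by exists 0; rewrite comp_mpoly0 subrr mulr0.
suff [q' e'] : P 'X_[m].
  exists (c *: q' + q); rewrite mulrDr -IH -scalerAr -e' comp_mpolyD comp_mpolyZ.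
  by rewrite scalerBr opprD addrACA.
rewrite mpolyXE_id; apply: (big_ind P) => // i _.
elim: (m i) => [//|k IHk]; rewrite exprS; apply: PM => //.
case: (eqVneq i i0) => [->|ii0].
  exists 1; rewrite comp_mpolyXU -tnth_nth tnth_mktuple eqxx opprK mulr1 power_sum1E.
  by rewrite [in RHS](bigD1 i0).
exists 0; rewrite mulr0 comp_mpolyXU -tnth_nth tnth_mktuple (negbTE ii0).
by rewrite subrr.
Qed.

(** After restriction to the hyperplane the left-hand side vanishes and the
    factor [power_sum n] does not.  Polynomials have no zero divisors, so [p]
    restricts to 0 and [elim_congr] exhibits the quotient. *)
Lemma power_sum1_dvd n p q : (1 < n)%N -> power_sum 1 * q = power_sum n * p ->
  exists r, p = power_sum 1 * r.
Proof.
move=> n1 /(congr1 (comp_mpoly elim0)); rewrite !rmorphM /=.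
have -> : power_sum 1 \mPo elim0 = 0.
  rewrite power_sum1E raddf_sum /= (bigD1 i0) //= comp_mpolyXU -tnth_nth tnth_mktuple eqxx.
  apply/eqP; rewrite addrC subr_eq0; apply/eqP; apply: eq_bigr => j /negbTE j0.
  by rewrite comp_mpolyXU -tnth_nth tnth_mktuple j0.
rewrite mul0r => /esym/eqP; rewrite mulf_eq0 (negbTE (power_sum_elim_neq0 n1)) /=.
by move=> /eqP p0; have [r] := elim_congr p; rewrite p0 subr0; exists r.
Qed.

Lemma power_sum1_neq0 : power_sum 1 != 0.
Proof.
apply/eqP => /(congr1 (meval (fun i => (i == i0)%:R))).
rewrite power_sum1E (big_morph _ (mevalD _) (meval0 _)) meval0 (bigD1 i0) //= mevalXU eqxx big1.
  by rewrite addr0 => /eqP; rewrite oner_eq0.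
by move=> j /negbTE j0; rewrite mevalXU j0.
Qed.

Definition monom (I : 'I_s -> nat) : 'X_{1..s} := [multinom I j | j < s].

Lemma fun_of_monom (I : 'I_s -> nat) : (fun i => monom I i) = I.
Proof. by apply: boolp.funext => i; rewrite mnmE. Qed.

Lemma monomK (J : 'X_{1..s}) : monom (fun i => J i) = J.
Proof. by apply/mnmP => i; rewrite mnmE. Qed.

End Divide.

Lemma psum_mul1_inj (F : realFieldType) s (b : ('I_s -> nat) -> F) m :
  (2 < s)%N -> (forall I, (m < deg I)%N -> b I = 0) ->
  (forall I, psum_mul 1 b I = 0) -> forall I, b I = 0.
Proof.
move=> s3 bm b0 I; rewrite -(fun_of_monom I) -(mcoeff_poly_of bm).
suff /eqP: power_sum F s 1 * poly_of m b = 0.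
  rewrite mulf_eq0 (negbTE (power_sum1_neq0 _ s3)) /= => /eqP ->.
  by rewrite mcoeff0.
rewrite (@power_sum_poly_of _ _ _ 1 0 b) ?scale0r // => J.
by rewrite b0 mul0r.
Qed.

(** The quotient is cut down to its homogeneous part of degree m - 1, which is
    all that contributes in degree m. *)
Lemma psum_mul_divide (F : realFieldType) s m n (k : F) (a b : ('I_s -> nat) -> F) :
  (2 < s)%N -> (1 < n)%N -> k != 0 ->
  (forall I, deg I != m -> a I = 0) ->
  (forall I, (deg I).+1 != (m + n)%N -> b I = 0) ->
  (forall I, psum_mul 1 b I = k * psum_mul n a I) ->
  exists c : ('I_s -> nat) -> F,
    (forall I, (deg I).+1 != m -> c I = 0) /\ forall I, a I = psum_mul 1 c I.
Proof.
move=> s3 n1 k0 ah bh ba.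
have am I : (m + n < deg I)%N -> a I = 0 by move=> ?; apply: ah; lia.
have bm I : (m + n < deg I)%N -> b I = 0 by move=> ?; apply: bh; lia.
have /(power_sum1_dvd s3 n1)[r er] :
  power_sum F s 1 * poly_of (m + n) b
  = power_sum F s n * (k *: poly_of (m + n) a).
  by rewrite -scalerAr (power_sum_poly_of am bm ba).
pose c I := mcoeff (monom I) (k^-1 *: r).
have ac I : a I = psum_mul 1 c I.
  rewrite -(fun_of_monom I) -(mcoeff_poly_of am).
  rewrite -[poly_of _ _]scale1r -(mulVf k0) -scalerA er scalerAr.
  by apply: mcoeff_power_sum_mul => J; rewrite /c monomK.
exists (fun I => if (deg I).+1 == m then c I else 0); split.
  by move=> I /negbTE ->.
move=> I; have [dI|dI] := eqVneq (deg I) m.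
  rewrite ac; apply: eq_bigr => j _; case: ifPn => // Ij.
  by have := deg_shift Ij; rewrite dI addn1 => ->; rewrite eqxx.
rewrite ah //; apply/esym/big1 => j _; case: ifPn => // Ij.
by have := deg_shift Ij; rewrite addn1 => ->; rewrite (negbTE dI).
Qed.

End PowerSums.

From mathcomp Require Import all_classical all_reals all_analysis.
Import numFieldNormedType.Exports.
Local Open Scope classical_set_scope.

(** * Symmetry of second partial derivatives *)
Section Clairaut.
Variable R : realType.

Lemma MVT_step (f df : R -> R) (a h : R) : 0 < h ->
  (forall x : R, is_derive x 1 f (df x)) ->
  exists x, [/\ a < x, x < a + h & f (a + h) - f a = df x * h].
Proof.
move=> h0 fdf; have ah : a < a + h by rewrite ltrDl.
have [|x] := MVT ah (fun x _ => fdf x).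
  by apply: derivable_within_continuous => x _; exact: ex_derive.
by rewrite in_itv /= => /andP[ax xh] ->; exists x; split=> //; ring.
Qed.

(** The second difference
    g (a + h) (b + h) - g (a + h) b - g a (b + h) + g a b
    is h^2 times a value of [gyz], and also h^2 times a value of [gzy], at points
    within h of (a, b): apply the mean value theorem twice, in either order.
    Continuity at (a, b) identifies the two limits. *)
Lemma clairaut_plane (g gy gz gyz gzy : R -> R -> R) (a b : R) :
  (forall y z : R, is_derive y 1 (g^~ z) (gy y z)) ->
  (forall y z : R, is_derive z 1 (g y) (gz y z)) ->
  (forall y z : R, is_derive z 1 (gy y) (gyz y z)) ->
  (forall y z : R, is_derive y 1 (gz^~ z) (gzy y z)) ->
  {for (a, b), continuous (fun yz => gyz yz.1 yz.2)} ->
  {for (a, b), continuous (fun yz => gzy yz.1 yz.2)} ->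
  gyz a b = gzy a b.
Proof.
move=> Hgy Hgz Hgyz Hgzy Cyz Czy; apply/eqP; rewrite -subr_eq0 -normr_le0.
apply/ler_addgt0Pr => e e0; rewrite add0r; have e2 : 0 < e / 2 by rewrite divr_gt0.
have [d d0 dP] : exists2 d : R, 0 < d & forall y z, `|y - a| < d -> `|z - b| < d ->
    `|gyz y z - gyz a b| < e / 2 /\ `|gzy y z - gzy a b| < e / 2.
  move/cvgrPdist_lt: (Cyz) => /(_ _ e2) N1; move/cvgrPdist_lt: (Czy) => /(_ _ e2) N2.
  have [d /= d0 dP] := (nbhs_ballP _ _).1 (filterI N1 N2).
  exists d => // y z ya zb; have := dP (y, z).
  rewrite /= distrC [X in _ /\ X < _]distrC; apply.
  by split; rewrite /ball /= distrC.
(* Strictly below [d], so that points within [h] of (a, b) are within [d]. *)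
pose h := d / 2; have h0 : 0 < h by rewrite divr_gt0.
have hd : h < d by rewrite /h; lra.
have near_lt (u v : R) : u < v -> v < u + h -> `|v - u| < d.
  by move=> uv vh; rewrite gtr0_norm ?subr_gt0 //; lra.
have [y [ay yh Ey]] := @MVT_step (fun y => g y (b + h) - g y b) _ a h h0
  (fun y => is_deriveB (Hgy y (b + h)) (Hgy y b)).
have [z [bz zh Ez]] := MVT_step b h0 (Hgyz y).
have [z' [bz' zh' Ez']] := @MVT_step (fun z => g (a + h) z - g a z) _ b h h0
  (fun z => is_deriveB (Hgz (a + h) z) (Hgz a z)).
have [y' [ay' yh' Ey']] := MVT_step a h0 (Hgzy^~ z').
have E : gyz y z = gzy y' z'.
  apply: (mulIf (lt0r_neq0 h0)); apply: (mulIf (lt0r_neq0 h0)).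
  rewrite -Ez -Ey' -Ey -Ez'; ring.
have [D1 _] := dP _ _ (near_lt _ _ ay yh) (near_lt _ _ bz zh).
have [_ D2] := dP _ _ (near_lt _ _ ay' yh') (near_lt _ _ bz' zh').
rewrite (_ : gyz a b - gzy a b = (gzy y' z' - gzy a b) - (gyz y z - gyz a b)).
  by rewrite (le_trans (ler_normB _ _)) //; lra.
by rewrite E; ring.
Qed.

End Clairaut.

(** * Smooth functions of finitely many coordinates *)
Section Smooth.
Variable R : realType.
Implicit Types (f g : Rinfty R -> R) (p q : Rinfty R) (c d : jcoord).

(** Moving two coordinates is a continuous map from the plane, so continuity for
    the product topology gives joint continuity in any two coordinates; this is
    the form in which [clairaut_plane] needs it. *)
Lemma dfwith2_continuous p c d :
  continuous (fun yz : R * R => dfwith (dfwith p c yz.1) d yz.2 : Rinfty R).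
Proof.
move=> yz; apply/cvg_sup => e U [V] [[W] oW <-] WV VU; apply: (filterS VU).
have : {for yz, continuous (fun yz : R * R => dfwith (dfwith p c yz.1) d yz.2 e)}.
  have [<-|de] := eqVneq d e.
    rewrite (_ : (fun _ => _) = snd); first exact: cvg_snd.
    by apply/funext => ?; rewrite dfwithin.
  have [ce|ce] := eqVneq c e.
    rewrite (_ : (fun _ => _) = fst); first exact: cvg_fst.
    by apply/funext => ?; rewrite dfwithout // -ce dfwithin.
  rewrite (_ : (fun _ => _) = fun=> p e); first exact: cvg_cst.
  by apply/funext => ?; rewrite !dfwithout.
by apply; apply: open_nbhs_nbhs.
Qed.

Lemma dfwith_id p c : dfwith p c (p c) = p.
Proof. by apply/funext => e; case: dfwithP. Qed.

Lemma dfwith_idem p c y z : dfwith (dfwith p c y) c z = dfwith p c z.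
Proof.
apply/funext => e; case: dfwithP => [|e' ce]; first by rewrite dfwithin.
by rewrite !dfwithout.
Qed.

Lemma dfwithC p c d y z : c != d ->
  dfwith (dfwith p c y) d z = dfwith (dfwith p d z) c y.
Proof.
move=> cd; apply/funext => e; have [<-|de] := eqVneq d e.
  by rewrite dfwithin dfwithout // dfwithin.
rewrite dfwithout //; have [<-|ce] := eqVneq c e; first by rewrite !dfwithin.
by rewrite !dfwithout.
Qed.

Definition partially_derivable f := forall c p, derivable (slice f p c) (p c) 1.

Lemma is_derive_slice f p c (y : R) : partially_derivable f ->
  is_derive y 1 (fun y => f (dfwith p c y)) (pd c f (dfwith p c y)).
Proof.
move=> /(_ c (dfwith p c y))/derivableP; rewrite -derive1E /pd dfwithin.
suff -> : slice f (dfwith p c y) c = fun y => f (dfwith p c y) by [].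
by apply/funext => z; rewrite /slice dfwith_idem.
Qed.

Lemma smooth_partially_derivable f : smooth f -> partially_derivable f.
Proof. by move=> [_ /(_ [::])[_]]. Qed.

Lemma smooth_continuous f : smooth f -> continuous f.
Proof. by move=> [_ /(_ [::])[+ _]]. Qed.

(** Smoothness speaks of all iterated partial derivatives, so it is proved by
    exhibiting a class of functions stable under partial derivatives. *)
Lemma smooth_coind (S : set (Rinfty R -> R)) :
  (forall f, S f -> continuous f /\ partially_derivable f) ->
  (forall f c, S f -> S (pd c f)) ->
  forall f, S f -> (exists n, depends_upto n f) -> smooth f.
Proof.
move=> S1 S2 f Sf fn; split=> // l; elim/last_ind: l f Sf {fn} => [|l c IH] f Sf /=.
  exact: S1.
by rewrite foldr_rcons; apply/IH/S2.
Qed.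

Lemma depends_upto_le n m f : (n <= m)%N -> depends_upto n f -> depends_upto m f.
Proof. by move=> nm fn p q pt px pu; apply: fn => // i /leq_trans/(_ nm)/pu. Qed.

Definition beyond n c := if c is cu i then (n < i)%N else false.

Lemma depends_agree n f p q : depends_upto n f ->
  (forall c, ~~ beyond n c -> p c = q c) -> f p = f q.
Proof. by move=> fn pq; apply: fn => [||i ni]; apply: pq; rewrite //= -leqNgt. Qed.

Lemma pd_beyond n f c : depends_upto n f -> beyond n c -> pd c f = fun=> 0.
Proof.
move=> fn nc; apply/funext => p; rewrite /pd (_ : slice f p c = cst (f p)).
  by rewrite derive1_cst.
apply/funext => y; apply: (depends_agree fn) => d nd; rewrite dfwithout //.
by apply: contraNneq nd => <-.
Qed.

Lemma depends_pd n f c : depends_upto n f -> depends_upto n (pd c f).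
Proof.
move=> fn p q pt px pu; have [nc|nc] := boolP (beyond n c).
  by rewrite (pd_beyond fn nc).
have pq d : ~~ beyond n d -> p d = q d.
  by case: d => //= i; rewrite -leqNgt; apply: pu.
rewrite /pd (pq c nc); congr (derive1 _ _); apply/funext => y.
apply: (depends_agree fn) => d /pq e.
have [<-|cd] := eqVneq c d; first by rewrite !dfwithin.
by rewrite !dfwithout.
Qed.

Lemma smooth_pd c f : smooth f -> smooth (pd c f).
Proof.
move=> [[n fn] fl]; split; first by exists n; apply: depends_pd.
by move=> l; have := fl (rcons l c); rewrite foldr_rcons.
Qed.

Lemma pd_is_derive c f p df : is_derive (p c) 1 (slice f p c) df -> pd c f p = df.
Proof. by move=> fd; rewrite /pd derive1E derive_val. Qed.

Lemma slice_is_derive c f p : partially_derivable f -> is_derive (p c) 1 (slice f p c) (pd c f p).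
Proof. by move=> /(_ c p)/derivableP; rewrite -derive1E. Qed.

Lemma pdD c f g : partially_derivable f -> partially_derivable g ->
  pd c (fun p => f p + g p) = fun p => pd c f p + pd c g p.
Proof.
move=> fd gd; apply/funext => p; apply: pd_is_derive.
exact: is_deriveD (slice_is_derive c p fd) (slice_is_derive c p gd).
Qed.

Lemma pdM c f g : partially_derivable f -> partially_derivable g ->
  pd c (fun p => f p * g p) = fun p => pd c f p * g p + f p * pd c g p.
Proof.
move=> fd gd; apply/funext => p; apply: pd_is_derive.
apply: (is_derive_eq (is_deriveM (slice_is_derive c p fd) (slice_is_derive c p gd))).
by rewrite /slice dfwith_id addrC; congr (_ + _); rewrite -[LHS]/(_ * _) mulrC.
Qed.

Lemma pd_cst c (a : R) : pd c (fun=> a) = fun=> 0.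
Proof. by apply/funext => p; apply: pd_is_derive; apply: is_derive_cst. Qed.

Lemma pd_coord c d : pd c (fun p => p d) = fun=> (c == d)%:R.
Proof.
apply/funext => p; apply: pd_is_derive; rewrite /slice.
have [->|cd] := eqVneq c d.
  by under eq_fun do rewrite dfwithin; apply: is_derive_id.
by under eq_fun do rewrite dfwithout //; apply: is_derive_cst.
Qed.

Lemma partially_derivableD f g :
  partially_derivable f -> partially_derivable g ->
  partially_derivable (fun p => f p + g p).
Proof.
move=> fd gd c p; have H := is_deriveD (slice_is_derive c p fd) (slice_is_derive c p gd).
exact: (@ex_derive _ _ _ _ _ _ _ H).
Qed.

Lemma partially_derivableM f g :
  partially_derivable f -> partially_derivable g ->
  partially_derivable (fun p => f p * g p).
Proof.
move=> fd gd c p; have H := is_deriveM (slice_is_derive c p fd) (slice_is_derive c p gd).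
exact: (@ex_derive _ _ _ _ _ _ _ H).
Qed.

Lemma smooth_cst (a : R) : smooth (fun=> a).
Proof.
apply: (@smooth_coind [set f | exists b, f = fun=> b]).
- move=> _ [b ->]; split=> [|c p].
    exact: cst_continuous.
  by rewrite -[slice _ _ _]/(cst b); apply: derivable_cst.
- by move=> _ c [b ->]; exists 0; rewrite pd_cst.
- by exists a.
- by exists 0%N.
Qed.

Lemma smooth_coord d : smooth (fun p => p d).
Proof.
apply: (@smooth_coind [set f | f = (fun p => p d) \/ smooth f]); last 2 first.
- by left.
- exists (if d is cu i then i else 0%N) => p q pt px pu.
  by case: d pu => [||i] // /(_ i); apply.
- move=> f [->|fs]; last by split; [apply: smooth_continuous|apply: smooth_partially_derivable].
  split=> [|c p]; first exact: (@proj_continuous _ (fun=> R)).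
  rewrite /slice; have [->|cd] := eqVneq c d.
    by under eq_fun do rewrite dfwithin; apply: derivable_id.
  by under eq_fun do rewrite dfwithout //; apply: derivable_cst.
- move=> f c [->|fs]; right; last exact: smooth_pd.
  by rewrite pd_coord; apply: smooth_cst.
Qed.

Lemma depends2 (h : R -> R -> R) f g : smooth f -> smooth g ->
  exists n, depends_upto n (fun p => h (f p) (g p)).
Proof.
move=> [[n fn] _] [[m gm] _]; exists (maxn n m) => p q pt px pu.
rewrite (fn p q) ?(gm p q) // => i ii; apply: pu; rewrite leq_max ii ?orbT //.
Qed.

Lemma smoothD f g : smooth f -> smooth g -> smooth (fun p => f p + g p).
Proof.
move=> fs gs; apply: (@smooth_coind
  [set h | exists f g, [/\ smooth f, smooth g & h = fun p => f p + g p]]).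
- move=> _ [{fs gs}f [{}g [fs gs ->]]]; split=> [p|].
    exact: (continuousD (@smooth_continuous _ fs p) (@smooth_continuous _ gs p)).
  exact: (partially_derivableD (smooth_partially_derivable fs) (smooth_partially_derivable gs)).
- move=> _ c [{fs gs}f [{}g [fs gs ->]]]; exists (pd c f), (pd c g).
  split; [exact: smooth_pd|exact: smooth_pd|].
  exact: pdD (smooth_partially_derivable fs) (smooth_partially_derivable gs).
- by exists f, g.
- exact: (depends2 +%R).
Qed.

(** Partial derivatives of a product of smooth functions are sums of such
    products, which is the stability that [smooth_coind] asks for. *)
Inductive mulspan : (Rinfty R -> R) -> Prop :=
| Mulspan_mul f g of smooth f & smooth g : mulspan (fun p => f p * g p)
| Mulspan_add f g of mulspan f & mulspan g : mulspan (fun p => f p + g p).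

Lemma mulspan_reg f : mulspan f -> continuous f /\ partially_derivable f.
Proof.
elim=> {}f g => [fs gs|_ [fc fd] _ [gc gd]]; split; try move=> p.
- exact: (continuousM (@smooth_continuous _ fs p) (@smooth_continuous _ gs p)).
- exact: (partially_derivableM (smooth_partially_derivable fs) (smooth_partially_derivable gs)).
- exact: (continuousD (fc p) (gc p)).
- exact: (partially_derivableD fd gd).
Qed.

Lemma smoothM f g : smooth f -> smooth g -> smooth (fun p => f p * g p).
Proof.
move=> fs gs; apply: (@smooth_coind mulspan).
- exact: mulspan_reg.
- move=> h c; elim=> {fs gs}f {}g => [fs gs|/mulspan_reg[_ fs] ? /mulspan_reg[_ gs] ?].
    rewrite (pdM c (smooth_partially_derivable fs) (smooth_partially_derivable gs)).
    exact: Mulspan_add (Mulspan_mul (smooth_pd c fs) gs) (Mulspan_mul fs (smooth_pd c gs)).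
  by rewrite (pdD c fs gs); apply: Mulspan_add.
- exact: Mulspan_mul.
- exact: (depends2 *%R).
Qed.

Lemma smoothZ a f : smooth f -> smooth (fun p => a * f p).
Proof. exact/smoothM/smooth_cst. Qed.

Lemma smoothB f g : smooth f -> smooth g -> smooth (fun p => f p - g p).
Proof.
move=> fs gs; rewrite (_ : (fun _ => _) = fun p => f p + -1 * g p).
  exact/smoothD/smoothZ.
by apply/funext => p; rewrite mulN1r.
Qed.

Lemma smooth_sum (I : Type) (r : seq I) (P : pred I) (F : I -> Rinfty R -> R) :
  (forall i, P i -> smooth (F i)) -> smooth (fun p => \sum_(i <- r | P i) F i p).
Proof.
move=> Fs; elim: r => [|i r IH].
  by under eq_fun do rewrite big_nil; apply: smooth_cst.
case Pi: (P i); last by under eq_fun do rewrite big_cons Pi.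
rewrite (_ : (fun _ => _) = fun p => F i p + \sum_(j <- r | P j) F j p).
  exact: (smoothD (Fs i Pi) IH).
by apply/funext => p; rewrite big_cons Pi.
Qed.

Lemma smooth_prod (I : Type) (r : seq I) (P : pred I) (F : I -> Rinfty R -> R) :
  (forall i, P i -> smooth (F i)) -> smooth (fun p => \prod_(i <- r | P i) F i p).
Proof.
move=> Fs; elim: r => [|i r IH].
  by under eq_fun do rewrite big_nil; apply: smooth_cst.
case Pi: (P i); last by under eq_fun do rewrite big_cons Pi.
rewrite (_ : (fun _ => _) = fun p => F i p * \prod_(j <- r | P j) F j p).
  exact: (smoothM (Fs i Pi) IH).
by apply/funext => p; rewrite big_cons Pi.
Qed.

Lemma pdC c d f : smooth f -> pd c (pd d f) = pd d (pd c f).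
Proof.
move=> fs; have [->//|cd] := eqVneq c d; apply/funext => p.
pose P y z : Rinfty R := dfwith (dfwith p c y) d z.
have Pp : P (p c) (p d) = p by rewrite /P !dfwith_id.
have PC y z : P y z = dfwith (dfwith p d z) c y by rewrite /P dfwithC.
have H1 h : smooth h -> forall y z : R, is_derive y 1 (fun y => h (P y z)) (pd c h (P y z)).
  move=> /smooth_partially_derivable hd y z; under eq_fun do rewrite PC; rewrite PC.
  exact: is_derive_slice.
have H2 h : smooth h -> forall y z : R, is_derive z 1 (fun z => h (P y z)) (pd d h (P y z)).
  by move=> /smooth_partially_derivable hd y z; apply: is_derive_slice.
have CP h : smooth h -> {for (p c, p d), continuous (fun yz : R * R => h (P yz.1 yz.2))}.
  move=> /smooth_continuous hc; apply: continuous_comp; last exact: hc.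
  exact: dfwith2_continuous.
have fc := smooth_pd c fs; have fd := smooth_pd d fs.
have := clairaut_plane (H1 f fs) (H2 f fs) (H2 _ fc) (H1 _ fd)
  (CP _ (smooth_pd d fc)) (CP _ (smooth_pd c fd)).
by rewrite Pp => ->.
Qed.

End Smooth.

(** * Derivations given by vector fields *)
Section VectorFields.
Variable R : realType.
Implicit Types (f g : Rinfty R -> R) (p q : Rinfty R) (c d : jcoord) (V W : @vfield R).

Definition coords n : seq jcoord := ct :: cx :: [seq cu i | i <- index_iota 0 n.+1].

Lemma coords_uniq n : uniq (coords n).
Proof.
have N c (r : seq nat) : (forall i, c != cu i) -> c \notin [seq cu i | i <- r].
  by move=> cN; apply/negP => /mapP[i _ ci]; have := cN i; rewrite ci eqxx.
rewrite /coords (cons_uniq ct) (cons_uniq cx) map_inj_uniq => [|i j [] //].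
by rewrite iota_uniq andbT in_cons negb_or !N.
Qed.

Lemma cu_coords n i : (cu i \in coords n) = (i <= n)%N.
Proof.
rewrite /coords (in_cons ct) (in_cons cx) mem_map => [|j k [] //].
by rewrite mem_index_iota.
Qed.

Lemma coords_beyond n c : (c \in coords n) = ~~ beyond n c.
Proof.
case: c => [||i]; last by rewrite cu_coords leqNgt.
  by rewrite /coords mem_head.
by rewrite /coords (in_cons ct) mem_head orbT.
Qed.

(** Only the coordinates on which [f] depends contribute, so the formally infinite
    directional derivative is a sum over an explicit list, and the rules of
    calculus follow term by term. *)
Lemma dirD_fin n f (v : tvec R) p : depends_upto n f ->
  dirD v f p = \sum_(c <- coords n) v c * pd c f p.
Proof.
move=> fn; rewrite /dirD (fsbigE (coords n)).
- by rewrite big_mkcond; apply: eq_bigr => c _; rewrite in_setT.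
- exact: coords_uniq.
- by [].
- by move=> c _; rewrite coords_beyond negbK => nc; rewrite (pd_beyond fn nc) mulr0.
Qed.

Lemma vfact_fin n f V : depends_upto n f ->
  vfact V f = fun p => \sum_(c <- coords n) V p c * pd c f p.
Proof. by move=> fn; apply/funext => p; apply: dirD_fin. Qed.

Definition smooth_vf V := forall c, smooth (fun p => V p c).

Lemma smooth_vfact f V : smooth_vf V -> smooth f -> smooth (vfact V f).
Proof.
move=> Vs fs; have [[n fn] _] := fs; rewrite (vfact_fin V fn).
by apply: smooth_sum => c _; exact: smoothM (Vs c) (smooth_pd c fs).
Qed.

Lemma depends2_max f g : smooth f -> smooth g ->
  exists n, depends_upto n f /\ depends_upto n g.
Proof.
move=> [[n fn] _] [[m gm] _]; exists (maxn n m); split.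
  exact: depends_upto_le (leq_maxl _ _) fn.
exact: depends_upto_le (leq_maxr _ _) gm.
Qed.

Lemma vfactD V f g : smooth f -> smooth g ->
  vfact V (fun p => f p + g p) = fun p => vfact V f p + vfact V g p.
Proof.
move=> fs gs; have [n [fn gn]] := depends2_max fs gs.
have fgn : depends_upto n (fun p => f p + g p).
  by move=> p q pt px pu; rewrite (fn p q) // (gn p q).
rewrite (vfact_fin V fgn) (vfact_fin V fn) (vfact_fin V gn); apply/funext => p.
rewrite -big_split /=; apply: eq_bigr => c _.
by rewrite (pdD c (smooth_partially_derivable fs) (smooth_partially_derivable gs)) mulrDr.
Qed.

Lemma vfactM V f g : smooth f -> smooth g ->
  vfact V (fun p => f p * g p) = fun p => vfact V f p * g p + f p * vfact V g p.
Proof.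
move=> fs gs; have [n [fn gn]] := depends2_max fs gs.
have fgn : depends_upto n (fun p => f p * g p).
  by move=> p q pt px pu; rewrite (fn p q) // (gn p q).
rewrite (vfact_fin V fgn) (vfact_fin V fn) (vfact_fin V gn); apply/funext => p.
rewrite mulr_suml mulr_sumr -big_split /=; apply: eq_bigr => c _.
rewrite (pdM c (smooth_partially_derivable fs) (smooth_partially_derivable gs)) mulrDr; ring.
Qed.

Lemma vfact_cst V (a : R) : vfact V (fun=> a) = fun=> 0.
Proof.
rewrite (@vfact_fin 0 (fun=> a)); last by [].
by apply/funext => p; apply: big1 => c _; rewrite pd_cst mulr0.
Qed.

Lemma vfactZ V (a : R) f : smooth f ->
  vfact V (fun p => a * f p) = fun p => a * vfact V f p.
Proof.
move=> fs; rewrite (vfactM V (smooth_cst a) fs) vfact_cst.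
by apply/funext => p; rewrite mul0r add0r.
Qed.

Lemma vfactB V f g : smooth f -> smooth g ->
  vfact V (fun p => f p - g p) = fun p => vfact V f p - vfact V g p.
Proof.
move=> fs gs; under [in LHS]eq_fun do rewrite -mulN1r.
rewrite (vfactD V fs (smoothZ _ gs)) vfactZ //.
by apply/funext => p; rewrite mulN1r.
Qed.

Lemma vfact_coord V d : vfact V (fun p => p d) = fun p => V p d.
Proof.
have [n dn] : exists n, ~~ beyond n d.
  by exists (if d is cu i then i else 0%N); case: d => //= i; rewrite ltnn.
have dfin : depends_upto n (fun p : Rinfty R => p d).
  by move=> p q pt px pu; case: d dn => [||i] //=; rewrite -leqNgt => /pu.
rewrite (vfact_fin V dfin); apply/funext => p.
rewrite (bigD1_seq d) ?coords_uniq ?coords_beyond //= pd_coord eqxx mulr1 big1 ?addr0 // => c cd.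
by rewrite pd_coord (negbTE cd) mulr0.
Qed.

Lemma vfact_sum V (I : Type) (r : seq I) (P : pred I) (F : I -> Rinfty R -> R) :
  (forall i, smooth (F i)) ->
  vfact V (fun p => \sum_(i <- r | P i) F i p) =
  fun p => \sum_(i <- r | P i) vfact V (F i) p.
Proof.
move=> Fs; elim: r => [|i r IH].
  under eq_fun do rewrite big_nil; rewrite vfact_cst.
  by apply/funext => p; rewrite big_nil.
case Pi: (P i); last first.
  under eq_fun do rewrite big_cons Pi.
  by rewrite IH; apply/funext => p; rewrite big_cons Pi.
under eq_fun do rewrite big_cons Pi.
rewrite (vfactD V (Fs i) (smooth_sum r (fun i _ => Fs i))) IH.
by apply/funext => p; rewrite big_cons Pi.
Qed.

Lemma vfact_prod V n (F : 'I_n -> Rinfty R -> R) : (forall i, smooth (F i)) ->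
  vfact V (fun p => \prod_i F i p) =
  fun p => \sum_i \prod_j (if j == i then vfact V (F j) p else F j p).
Proof.
elim: n F => [|n IH] F Fs; apply/funext => p.
  by under eq_fun do rewrite big_ord0; rewrite vfact_cst big_ord0.
under eq_fun do rewrite big_ord_recl.
have Gs : smooth (fun p => \prod_(i < n) F (lift ord0 i) p).
  by apply: smooth_prod => i _.
rewrite (vfactM V (Fs ord0) Gs) (IH _ (fun i => Fs (lift ord0 i))) [RHS]big_ord_recl /=.
rewrite [in RHS]big_ord_recl /=; congr (_ * _ + _).
rewrite mulr_sumr; apply: eq_bigr => i _.
rewrite [RHS]big_ord_recl /=; congr (_ * _); apply: eq_bigr => j _.
Qed.

(** The terms with second derivatives of [f] cancel by [pdC]; what remains is the
    action of the bracket [V, W], computed componentwise. *)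
Lemma vfact_comm V W f : smooth_vf V -> smooth_vf W -> smooth f ->
  forall n p, depends_upto n f ->
  vfact V (vfact W f) p = vfact W (vfact V f) p +
    \sum_(c <- coords n) (vfact V (fun q => W q c) p - vfact W (fun q => V q c) p)
      * pd c f p.
Proof.
move=> Vs Ws fs n p fn.
have E U U' : smooth_vf U -> smooth_vf U' -> vfact U (vfact U' f) p =
    \sum_(c <- coords n) vfact U (fun q => U' q c) p * pd c f p +
    \sum_(c <- coords n) \sum_(d <- coords n) U' p c * U p d * pd d (pd c f) p.
  move=> Us U's; rewrite (vfact_fin U' fn) vfact_sum; last first.
    by move=> c; exact: smoothM (U's c) (smooth_pd c fs).
  rewrite -big_split /=; apply: eq_bigr => c _.
  rewrite (vfactM U (U's c) (smooth_pd c fs)); congr (_ + _).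
  rewrite (vfact_fin U (depends_pd c fn)) mulr_sumr.
  by apply: eq_bigr => d _; rewrite mulrA.
rewrite (E V W) // (E W V) //.
have -> : \sum_(c <- coords n) \sum_(d <- coords n) W p c * V p d * pd d (pd c f) p
        = \sum_(c <- coords n) \sum_(d <- coords n) V p c * W p d * pd d (pd c f) p.
  rewrite exchange_big /=; apply: eq_bigr => d _; apply: eq_bigr => c _.
  by rewrite pdC // [W p c * _]mulrC.
under [X in _ = _ + X]eq_bigr do rewrite mulrBl.
by rewrite sumrB [RHS]addrC addrA subrK.
Qed.

(** A partial derivative is the action of a coordinate field, so brackets with it
    are covered by [vfact_comm]. *)
Lemma pd_vfact c f : smooth f -> pd c f = vfact (fun _ d => (d == c)%:R) f.
Proof.
move=> fs; have [[n fn] _] := fs; apply/funext => p.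
rewrite (vfact_fin _ fn); have [cn|cn] := boolP (c \in coords n);
  last rewrite coords_beyond negbK in cn.
  rewrite (bigD1_seq c) ?coords_uniq //= eqxx mul1r big1 ?addr0 // => d dc.
  by rewrite (negbTE dc) mul0r.
rewrite (pd_beyond fn cn); apply/esym/big1_seq => d /andP[_ dn].
have [dc|_] := eqVneq d c; last by rewrite mul0r.
by rewrite dc (pd_beyond fn cn) mulr0.
Qed.

Lemma dirD_unit c f p : smooth f -> dirD (fun d => (d == c)%:R) f p = pd c f p.
Proof. by move=> fs; rewrite pd_vfact. Qed.

End VectorFields.

(** * The fields X and T and the contact forms *)
Section Equation.
Variables (R : realType) (n : nat) (K : Rinfty R -> R).
Hypotheses (Ks : smooth K) (Kn : depends_upto n K).
Implicit Types (f g : Rinfty R -> R) (p q : Rinfty R) (c d : jcoord).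

Local Notation X := (vfact (@Xvf R)).
Local Notation T := (vfact (Tvf K)).
Local Notation XK i := (iter i (vfact (@Xvf R)) K).

Lemma smooth_Xvf : smooth_vf (@Xvf R).
Proof. by case=> [||i]; [exact: smooth_cst|exact: smooth_cst|exact: smooth_coord]. Qed.

Lemma smooth_XK i : smooth (XK i).
Proof. elim: i => [|i IH]; [exact: Ks | exact: smooth_vfact smooth_Xvf IH]. Qed.

Lemma smooth_Tvf : smooth_vf (Tvf K).
Proof. by case=> [||i]; [exact: smooth_cst|exact: smooth_cst|exact: smooth_XK]. Qed.

Lemma coords_sum m (F : jcoord -> R) :
  \sum_(c <- coords m) F c = F ct + F cx + \sum_(k < m.+1) F (cu k).
Proof. by rewrite 2!big_cons big_map big_mkord addrA. Qed.

(** The bracket of X and T has components X (X^i K) - T (u_(i+1)), which vanish by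
    the definition of T. *)
Lemma vfact_XT f : smooth f -> X (T f) = T (X f).
Proof.
move=> fs; have [[m fm] _] := fs; apply/funext => p.
rewrite (vfact_comm smooth_Xvf smooth_Tvf fs p fm) big1 ?addr0 // => c _.
rewrite (_ : X _ p - T _ p = 0) ?mul0r //; apply/eqP; rewrite subr_eq0; apply/eqP.
case: c => [||i]; first by rewrite !vfact_cst.
  by rewrite !vfact_cst.
by rewrite -[fun q => Xvf q (cu i)]/(fun q => q (cu i.+1)) vfact_coord.
Qed.

(** The bracket of d/du_i and X is d/du_(i-1), because X has component u_i along
    d/du_(i-1). *)
Lemma pd_X i f : smooth f ->
  pd (cu i) (X f) = fun p => X (pd (cu i) f) p + (if i is j.+1 then pd (cu j) f p else 0).
Proof.
move=> fs; have [[m fm] _] := fs; apply/funext => p.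
pose U : @vfield R := fun _ d => (d == cu i)%:R.
have Us : smooth_vf U by move=> c; apply: smooth_cst.
(* With the larger bound, u_(i-1) is among the coordinates summed over. *)
have fmi : depends_upto (m + i) f by apply: depends_upto_le fm; apply: leq_addr.
rewrite (pd_vfact (cu i) fs) (pd_vfact (cu i) (smooth_vfact smooth_Xvf fs)).
rewrite -/U (vfact_comm Us smooth_Xvf fs p fmi); congr (_ + _).
rewrite coords_sum !vfact_cst !subrr !mul0r !add0r.
have E k : vfact U (fun q => Xvf q (cu k)) p - X (fun q => U q (cu k)) p = (k.+1 == i)%:R.
  rewrite vfact_cst subr0 -[fun q => Xvf q (cu k)]/(fun q => q (cu k.+1)) vfact_coord /U.
  by congr (nat_of_bool _)%:R; apply/eqP/eqP => [[]|->].
clear Us; case: i @U E fmi => [|j] U E fmi; first by apply: big1 => k _; rewrite E mul0r.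
have jm : (j < (m + j.+1).+1)%N by lia.
rewrite (bigD1 (Ordinal jm)) //= E eqxx mul1r big1 ?addr0 // => k.
rewrite -val_eqE /= E eqSS => /negbTE ->; exact: mul0r.
Qed.

Lemma depends_X m f : depends_upto m f -> depends_upto m.+1 (X f).
Proof.
move=> fm p q pt px pu; rewrite (vfact_fin _ fm); apply: eq_big_seq => c.
have E : pd c f p = pd c f q by apply: (depends_pd c fm) => // i im; apply: pu; lia.
by rewrite coords_beyond E; case: c {E} => [||i] //= im; rewrite pu //; lia.
Qed.

Lemma depends_XK j : depends_upto (n + j) (XK j).
Proof. by elim: j => [|j IH]; rewrite ?addn0 // addnS; apply: depends_X. Qed.

Lemma pd_XK_beyond i j : (n + j < i)%N -> pd (cu i) (XK j) = fun=> 0.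
Proof. by move=> ij; apply: (pd_beyond (@depends_XK j)). Qed.

(** Each application of X raises the order by one and carries the separant over
    to the new top coordinate. *)
Lemma pd_XK_top j : pd (cu (n + j)) (XK j) = pd (cu n) K.
Proof.
elim: j => [|j IH]; first by rewrite addn0.
rewrite iterS addnS (pd_X _ (smooth_XK j)) pd_XK_beyond ?vfact_cst ?IH //.
by apply/funext => p; rewrite add0r.
Qed.

(** The splitting of df into horizontal and vertical parts; for f = X^i K the
    vertical part is T (theta^i). *)
Lemma dirD_theta m f (v : tvec R) p : depends_upto m f ->
  dirD v f p = v cx * X f p + v ct * T f p +
    \sum_(k < m.+1) pd (cu k) f p * theta K k p v.
Proof.
move=> fm; rewrite (dirD_fin v p fm) !(vfact_fin _ fm) !coords_sum /=.
rewrite !mulrDr !mulr_sumr !mul0r !mul1r.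
set A := \sum_(k < _) _; set B := \sum_(k < _) _; set C := \sum_(k < _) _.
have -> : \sum_(k < m.+1) pd (cu k) f p * theta K k p v = A - B - C.
  rewrite -!sumrB; apply: eq_bigr => k _; rewrite /theta /dcoord; ring.
ring.
Qed.

(** The Lie derivative of a single covector field, in the same normalisation as
    [lie]. *)
Definition lie1 (V : @vfield R) (phi : @oneform R) : oneform := fun p v =>
  vfact V (fun q => phi q v) p + phi p (fun c => dirD v (fun q => V q c) p).

Definition smooth_form (phi : @oneform R) := forall v, smooth (fun p => phi p v).

Lemma smooth_theta i : smooth_form (theta K i).
Proof.
move=> v; have s1 := smoothM (smooth_XK i) (smooth_cst (v ct)).
have s2 := smoothM (@smooth_coord R (cu i.+1)) (smooth_cst (v cx)).
exact: (smoothB (smoothB (smooth_cst (v (cu i))) s1) s2).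
Qed.

Lemma vfact_theta V i p v :
  vfact V (fun q => theta K i q v) p
  = - vfact V (XK i) p * v ct - V p (cu i.+1) * v cx.
Proof.
have s1 := smoothM (smooth_XK i) (smooth_cst (v ct)).
have s2 := smoothM (@smooth_coord R (cu i.+1)) (smooth_cst (v cx)).
rewrite /theta /dcoord (vfactB V (smoothB (smooth_cst _) s1) s2).
rewrite (vfactB V (smooth_cst _) s1) (vfactM V (smooth_XK i) (smooth_cst _)).
rewrite (vfactM V (@smooth_coord R (cu i.+1)) (smooth_cst _)) !vfact_cst vfact_coord.
ring.
Qed.

Lemma dirD_cst (v : tvec R) (a : R) p : dirD v (fun=> a) p = 0.
Proof. by rewrite -[LHS]/(vfact (fun=> v) (fun=> a) p) vfact_cst. Qed.

Lemma dirD_coord (v : tvec R) c p : dirD v (fun q => q c) p = v c.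
Proof. by rewrite -[LHS]/(vfact (fun=> v) (fun q => q c) p) vfact_coord. Qed.

Lemma lie1_X_theta i : lie1 (@Xvf R) (theta K i) = theta K i.+1.
Proof.
apply/funext => p; apply/funext => v; rewrite /lie1 vfact_theta /theta /dcoord /=.
rewrite !dirD_cst dirD_coord; ring.
Qed.

(** T (theta^i) is the vertical part of d (X^i K); its terms in dt and dx cancel
    against those of theta^i. *)
Lemma lie1_T_theta i m : depends_upto m (XK i) ->
  lie1 (Tvf K) (theta K i) = fun p v =>
    \sum_(k < m.+1) pd (cu k) (XK i) p * theta K k p v.
Proof.
move=> fm; apply/funext => p; apply/funext => v.
rewrite /lie1 vfact_theta /theta /dcoord /= !dirD_cst.
rewrite (dirD_theta v p fm) /=; rewrite -/(theta K _ p v) /theta /dcoord; ring.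
Qed.

(** With [lie1_X_theta] and [lie1_T_theta] the two sides are sums over the theta^k,
    and comparing coefficients is exactly [pd_X] for X^i K. *)
Lemma lie1_XT_theta i :
  lie1 (@Xvf R) (lie1 (Tvf K) (theta K i)) = lie1 (Tvf K) (lie1 (@Xvf R) (theta K i)).
Proof.
rewrite lie1_X_theta (lie1_T_theta (@depends_XK i)) (lie1_T_theta (@depends_XK i.+1)).
apply/funext => p; apply/funext => v; rewrite /lie1.
rewrite vfact_sum => [|k]; last first.
  by apply: smoothM; [exact/smooth_pd/smooth_XK|exact: smooth_theta].
have E (k : nat) : vfact (@Xvf R) (fun q => pd (cu k) (XK i) q * theta K k q v) p +
    pd (cu k) (XK i) p * theta K k p (fun c => dirD v (fun q => Xvf q c) p) =
    X (pd (cu k) (XK i)) p * theta K k p v + pd (cu k) (XK i) p * theta K k.+1 p v.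
  rewrite (vfactM _ (smooth_pd _ (smooth_XK i)) (smooth_theta k v)) -addrA -mulrDr.
  by congr (_ + _ * _); rewrite -lie1_X_theta.
rewrite -big_split /= (eq_bigr _ (fun (k : 'I__) _ => E k)) big_split /= addnS.
under [RHS]eq_bigr do rewrite (pd_X _ (smooth_XK i)) mulrDl.
rewrite big_split /= [X in _ = X + _]big_ord_recr /= (pd_XK_beyond (leqnn _)) vfact_cst mul0r addr0.
by congr (_ + _); rewrite [RHS]big_ord_recl /= mul0r add0r.
Qed.

End Equation.

(** At distinct entries the two replacements do not interact; at equal entries
    they compose, and the hypothesis applies. *)
Lemma upd_swap (A : Type) (F G : A -> A) s (phi : 'I_s -> A) a b :
  (forall a, F (G (phi a)) = G (F (phi a))) ->
  upd (upd phi a (G (phi a))) b (F (upd phi a (G (phi a)) b)) =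
  upd (upd phi b (F (phi b))) a (G (upd phi b (F (phi b)) a)).
Proof.
move=> FG; apply/funext => c; rewrite /upd [a == b]eq_sym.
have [->|ba] := eqVneq b a; first by rewrite FG; case: eqP.
by have [->|//] := eqVneq c b; rewrite (negbTE ba).
Qed.

(** * Lie derivatives of tensor products of covectors *)
Section LieTensor.
Variable R : realType.
Implicit Types (f g : Rinfty R -> R) (p q : Rinfty R) (V W : @vfield R).

Definition smooth_kform s (w : @kform R s) := forall v, smooth (fun p => w p v).

Definition tens s f (phi : 'I_s -> @oneform R) : kform s :=
  fun p v => f p * \prod_a phi a p (v a).

Lemma smooth_tens s f (phi : 'I_s -> @oneform R) :
  smooth f -> (forall a, smooth_form (phi a)) -> smooth_kform (tens f phi).
Proof.
move=> fs ps v; apply: (smoothM fs).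
exact: (smooth_prod _ (fun a _ => ps a (v a))).
Qed.

Lemma lie0 V s : lie V (fun _ _ => 0 : R) = (fun _ _ => 0) :> kform s.
Proof.
apply/funext => p; apply/funext => v; rewrite /lie vfact_cst add0r.
exact: big1.
Qed.

Lemma lieD V s (w w' : @kform R s) : smooth_kform w -> smooth_kform w' ->
  lie V (fun p v => w p v + w' p v) = fun p v => lie V w p v + lie V w' p v.
Proof.
move=> ws ws'; apply/funext => p; apply/funext => v.
by rewrite /lie (vfactD V (ws v) (ws' v)) big_split /= addrACA.
Qed.

Lemma lieZ V s (a : R) (w : @kform R s) : smooth_kform w ->
  lie V (fun p v => a * w p v) = fun p v => a * lie V w p v.
Proof.
move=> ws; apply/funext => p; apply/funext => v.
by rewrite /lie (vfactZ V a (ws v)) -mulr_sumr mulrDr.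
Qed.

Lemma smooth_kform_sum s (I : Type) (r : seq I) (w : I -> @kform R s) :
  (forall i, smooth_kform (w i)) -> smooth_kform (fun p v => \sum_(i <- r) w i p v).
Proof. by move=> ws v; exact: (smooth_sum r (fun i _ => ws i v)). Qed.

Lemma lie_sum V s (I : Type) (r : seq I) (w : I -> @kform R s) :
  (forall i, smooth_kform (w i)) ->
  lie V (fun p v => \sum_(i <- r) w i p v) = fun p v => \sum_(i <- r) lie V (w i) p v.
Proof.
move=> ws; apply/funext => p; apply/funext => v.
rewrite /lie (vfact_sum V r xpredT (fun i => ws i v)) exchange_big /=.
by rewrite -big_split.
Qed.

(** The Leibniz rule.  In the definition of [lie], differentiating the factor [a]
    and replacing the argument [a] give the two terms of [lie1]. *)
Lemma lie_tens V s f (phi : 'I_s -> @oneform R) :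
  smooth f -> (forall a, smooth_form (phi a)) ->
  lie V (tens f phi) = fun p v => tens (vfact V f) phi p v +
    \sum_a tens f (upd phi a (lie1 V (phi a))) p v.
Proof.
move=> fs ps; apply/funext => p; apply/funext => v.
rewrite /lie /tens.
have Gs : smooth (fun q => \prod_a phi a q (v a)).
  exact: (smooth_prod _ (fun a _ => ps a (v a))).
rewrite (vfactM V fs Gs) (vfact_prod V (fun a => ps a (v a))) -addrA mulr_sumr.
rewrite -big_split /=; congr (_ + _); apply: eq_bigr => a _.
rewrite -mulrDr; congr (_ * _).
rewrite [X in X + _](bigD1 a) // [X in _ + X](bigD1 a) // [RHS](bigD1 a) //= /upd !eqxx.
rewrite /lie1 mulrDl; congr (_ * _ + _ * _); apply: eq_bigr => b /negbTE ba; rewrite ba //.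
Qed.

(** The commutator of two derivations is a derivation: the mixed terms, in which V
    and W hit different factors, agree after exchanging the two sums, and the
    others vanish by hypothesis. *)
Lemma lie_comm_tens V W s f (phi : 'I_s -> @oneform R) :
  smooth_vf V -> smooth_vf W ->
  smooth f -> (forall a, smooth_form (phi a)) ->
  (forall a, smooth_form (lie1 V (phi a))) -> (forall a, smooth_form (lie1 W (phi a))) ->
  vfact V (vfact W f) = vfact W (vfact V f) ->
  (forall a, lie1 V (lie1 W (phi a)) = lie1 W (lie1 V (phi a))) ->
  lie V (lie W (tens f phi)) = lie W (lie V (tens f phi)).
Proof.
move=> Vs Ws fs ps Vps Wps fVW pVW.
have us U a : (forall b, smooth_form (lie1 U (phi b))) ->
    forall b, smooth_form (upd phi a (lie1 U (phi a)) b).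
  by move=> Ups b; rewrite /upd; case: ifP.
pose D U U' p v := \sum_a \sum_b tens f (upd (upd phi a (lie1 U (phi a))) b
                 (lie1 U' (upd phi a (lie1 U (phi a)) b))) p v.
have E U U' : smooth_vf U -> smooth_vf U' ->
    (forall a, smooth_form (lie1 U (phi a))) ->
    lie U' (lie U (tens f phi)) = fun p v =>
      (tens (vfact U' (vfact U f)) phi p v +
        \sum_a tens (vfact U f) (upd phi a (lie1 U' (phi a))) p v) +
      (\sum_a tens (vfact U' f) (upd phi a (lie1 U (phi a))) p v +
        D U U' p v).
  move=> Us U's Ups; have Ufs := smooth_vfact Us fs.
  rewrite (lie_tens U fs ps) lieD; first last.
  - by apply: smooth_kform_sum => a; exact: smooth_tens fs (us U a Ups).
  - exact: smooth_tens Ufs ps.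
  rewrite (lie_tens U' Ufs ps) lie_sum; last first.
    by move=> a; exact: smooth_tens fs (us U a Ups).
  apply/funext => p; apply/funext => v; congr (_ + _); rewrite -big_split /=.
  by apply: eq_bigr => a _; rewrite (lie_tens U' fs (us U a Ups)).
rewrite (E W V Ws Vs Wps) (E V W Vs Ws Vps) fVW; apply/funext => p; apply/funext => v.
have DC : D W V p v = D V W p v.
  rewrite /D exchange_big; apply: eq_bigr => b _; apply: eq_bigr => a _.
  by rewrite (@upd_swap _ (lie1 V) (lie1 W) s phi a b pVW).
rewrite DC.
exact: addrACA.
Qed.

End LieTensor.

(** * Vertical tensors and their coefficients *)
Section Vertical.
Variables (R : realType) (n : nat) (K : Rinfty R -> R).
Hypotheses (Ks : smooth K) (Kn : depends_upto n K).
Implicit Types (f g : Rinfty R -> R) (p q : Rinfty R) (c d : jcoord).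

Local Notation X := (vfact (@Xvf R)).
Local Notation T := (vfact (Tvf K)).
Local Notation XK i := (iter i (vfact (@Xvf R)) K).
Local Notation lieX := (lie (@Xvf R)).
Local Notation lieT := (lie (Tvf K)).

Definition thetas s (I : 'I_s -> nat) : 'I_s -> @oneform R := fun a => theta K (I a).

(** The span of the tensors f theta^(i_1) (v_1) ... theta^(i_s) (v_s), without
    alternation.  It contains the forms of type (0,s) and is stable under X and T,
    and its elements correspond to finitely supported arrays of smooth
    coefficients. *)
Inductive vert s : kform s -> Prop :=
| Vert0 : vert (fun _ _ => 0)
| VertD w w' of vert w & vert w' : vert (fun p v => w p v + w' p v)
| Vert_tens f I of smooth f : vert (tens f (thetas I)).

Lemma smooth_thetas s (I : 'I_s -> nat) a : smooth_form (thetas I a).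
Proof. exact: smooth_theta. Qed.

Lemma smooth_vert s (w : kform s) : vert w -> smooth_kform w.
Proof.
elim=> {w} [v|w w' _ ws _ ws' v|f I fs].
- exact: smooth_cst.
- exact: smoothD (ws v) (ws' v).
- exact: smooth_tens fs (smooth_thetas I).
Qed.

Lemma vert_sum s (I : Type) (r : seq I) (w : I -> kform s) :
  (forall i, vert (w i)) -> vert (fun p v => \sum_(i <- r) w i p v).
Proof.
move=> ws; elim: r => [|i r IH].
  rewrite (_ : (fun _ _ => _) = fun _ _ => 0); first exact: Vert0.
  by apply/funext => p; apply/funext => v; rewrite big_nil.
rewrite (_ : (fun _ _ => _) = fun p v => w i p v + \sum_(i <- r) w i p v).
  exact: VertD (ws i) IH.
by apply/funext => p; apply/funext => v; rewrite big_cons.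
Qed.

Lemma vertZ s (a : R) (w : kform s) : vert w -> vert (fun p v => a * w p v).
Proof.
elim=> {w} [|w w' _ ws _ ws'|f I fs].
- by under eq_fun do under eq_fun do rewrite mulr0; apply: Vert0.
- by under eq_fun do under eq_fun do rewrite mulrDr; apply: VertD.
- rewrite (_ : (fun _ _ => _) = tens (fun p => a * f p) (thetas I)).
    exact/Vert_tens/smoothZ.
  by apply/funext => p; apply/funext => v; rewrite /tens mulrA.
Qed.

Lemma vertB s (w w' : kform s) : vert w -> vert w' -> vert (fun p v => w p v - w' p v).
Proof.
move=> ws ws'; rewrite (_ : (fun _ _ => _) = fun p v => w p v + -1 * w' p v).
  exact/VertD/vertZ.
by apply/funext => p; apply/funext => v; rewrite mulN1r.
Qed.

(** What makes a derivation preserve the span [vert]; both X and T qualify. *)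
Definition theta_stable (V : @vfield R) := forall i, exists m (g : 'I_m -> Rinfty R -> R),
  (forall k, smooth (g k)) /\
  lie1 V (theta K i) = fun p v => \sum_(k < m) g k p * theta K k p v.

Lemma X_stable : theta_stable (@Xvf R).
Proof.
move=> i; exists i.+2, (fun k _ => (k == ord_max)%:R); split=> [k|].
  exact: smooth_cst.
rewrite lie1_X_theta //; apply/funext => p; apply/funext => v.
rewrite (bigD1 ord_max) //= eqxx mul1r big1 ?addr0 // => k /negbTE ->.
exact: mul0r.
Qed.

Lemma T_stable : theta_stable (Tvf K).
Proof.
move=> i; exists (n + i).+1, (fun k : 'I__ => pd (cu k) (XK i)); split=> [k|].
  exact/smooth_pd/smooth_XK.
exact: lie1_T_theta (depends_XK Kn (j := i)).
Qed.

Lemma smooth_lie1_theta V i : theta_stable V -> smooth_form (lie1 V (theta K i)).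
Proof.
move=> /(_ i)[m [g [gs ->]]] v; apply: smooth_sum => k _.
exact: smoothM (gs k) (smooth_theta Ks k v).
Qed.

Lemma vert_lie s V (w : kform s) : smooth_vf V -> theta_stable V ->
  vert w -> vert (lie V w).
Proof.
move=> Vs Vt; elim=> {w} [|w w' wv IHw wv' IHw'|f I fs].
- by rewrite lie0; apply: Vert0.
- by rewrite (lieD V (smooth_vert wv) (smooth_vert wv')); apply: VertD.
rewrite (lie_tens V fs (smooth_thetas I)); apply: VertD.
  exact/Vert_tens/smooth_vfact.
apply: vert_sum => a; have [m [g [gs E]]] := Vt (I a).
rewrite (_ : tens _ _ = fun p v =>
    \sum_(k < m) tens (fun p => f p * g k p) (thetas (upd I a k)) p v).
  by apply: vert_sum => k; apply: Vert_tens; exact: smoothM fs (gs k).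
apply/funext => p; apply/funext => v; rewrite /tens (bigD1 a) //= /upd eqxx /thetas E.
rewrite mulr_suml mulr_sumr; apply: eq_bigr => k _; rewrite [in RHS](bigD1 a) //= eqxx.
rewrite -!mulrA; congr (_ * (_ * (_ * _))); apply: eq_bigr => b /negbTE ->.
by [].
Qed.

Lemma vert_lieX s (w : kform s) : vert w -> vert (lieX w).
Proof. exact/vert_lie/X_stable/smooth_Xvf. Qed.

Lemma vert_lieT s (w : kform s) : vert w -> vert (lieT w).
Proof. exact/vert_lie/T_stable/smooth_Tvf. Qed.

Lemma lie_XT s (w : kform s) : vert w -> lieX (lieT w) = lieT (lieX w).
Proof.
elim=> {w} [|w w' wv IHw wv' IHw'|f I fs]; first by rewrite !lie0.
- rewrite (lieD _ (smooth_vert wv) (smooth_vert wv')).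
  rewrite (lieD _ (smooth_vert (vert_lieT wv)) (smooth_vert (vert_lieT wv'))).
  rewrite (lieD _ (smooth_vert wv) (smooth_vert wv')).
  by rewrite (lieD _ (smooth_vert (vert_lieX wv)) (smooth_vert (vert_lieX wv'))) IHw IHw'.
apply: (lie_comm_tens (@smooth_Xvf R) (smooth_Tvf Ks) fs (smooth_thetas I)).
- by move=> a; exact: smooth_lie1_theta X_stable.
- by move=> a; exact: smooth_lie1_theta T_stable.
- exact: (vfact_XT Ks fs).
- by move=> a; exact: (lie1_XT_theta Ks Kn).
Qed.

(** The vectors d/du_(I a), dual to the covectors theta^(I a). *)
Definition dual_vec s (I : 'I_s -> nat) : 'I_s -> tvec R := fun a c => (c == cu (I a))%:R.

Definition coef s (w : kform s) (I : 'I_s -> nat) : Rinfty R -> R := fun p => w p (dual_vec I).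

Lemma coef_formD s (w w' : kform s) I p :
  coef (fun p v => w p v + w' p v) I p = coef w I p + coef w' I p.
Proof. by []. Qed.

Lemma theta_vertical (d : tvec R) i p : d ct = 0 -> d cx = 0 -> theta K i p d = d (cu i).
Proof. by move=> dt dx; rewrite /theta /dcoord dt dx !mulr0 !subr0. Qed.

Lemma theta_dual_vec s (I : 'I_s -> nat) a i p : theta K i p (dual_vec I a) = (i == I a)%:R.
Proof.
by rewrite theta_vertical.
Qed.

Lemma sum_delta N (F : nat -> R) i : (i < N)%N ->
  \sum_(k < N) F k * (i == k :> nat)%:R = F i.
Proof.
move=> iN; rewrite (bigD1 (Ordinal iN)) //= eqxx mulr1 big1 ?addr0 // => k.
by rewrite -val_eqE eq_sym /= => /negbTE ->; rewrite mulr0.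
Qed.

(** Multilinear expansion in the theta^k, whose coefficients are recovered by
    evaluating on the dual vectors.  Finitely many indices suffice, and any larger
    bound does as well, which lets two tensors be expanded over the same
    range. *)
Lemma vert_expand s (w : kform s) : vert w -> exists N0, forall N, (N0 <= N)%N ->
  forall p v, w p v =
    \sum_(J : {ffun 'I_s -> 'I_N}) coef w (fun a => J a) p * \prod_a theta K (J a) p (v a).
Proof.
elim=> {w} [|w w' _ [N1 h1] _ [N2 h2]|f I fs].
- exists 0%N => N _ p v; apply/esym/big1 => J _; exact: mul0r.
- exists (maxn N1 N2) => N; rewrite geq_max => /andP[N1N N2N] p v.
  rewrite (h1 N) // (h2 N) // -big_split; apply: eq_bigr => J _.
  by rewrite coef_formD mulrDl.
exists (\max_a (I a).+1)%N => N IN p v.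
have iN a : (I a < N)%N by apply: leq_trans IN; apply: (leq_bigmax a).
pose J0 : {ffun 'I_s -> 'I_N} := [ffun a => Ordinal (iN a)].
have E (J : {ffun 'I_s -> 'I_N}) :
    coef (tens f (thetas I)) (fun a => J a) p = f p * (J == J0)%:R.
  rewrite /coef /tens; congr (_ * _); under eq_bigr do rewrite /thetas theta_dual_vec.
  have [->|JJ0] := eqVneq J J0.
    by apply: big1 => a _; rewrite ffunE /= eqxx.
  have [a Ja] : exists a, J a != J0 a.
    by apply/existsP; apply: contraR JJ0 => /existsPn E; apply/eqP/ffunP => a;
       apply/eqP/negPn/E.
  rewrite (bigD1 a) //=; move: Ja; rewrite ffunE -val_eqE eq_sym /= => /negbTE ->.
  exact: mul0r.
rewrite (bigD1 J0) //= E eqxx mulr1 [X in _ + X]big1 ?addr0.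
  by rewrite /tens; congr (_ * _); apply: eq_bigr => a _; rewrite ffunE.
by move=> J /negbTE JJ0; rewrite E JJ0 mulr0 mul0r.
Qed.

Lemma vert_eq0 s (w : kform s) : vert w -> (forall I p, coef w I p = 0) ->
  w = fun _ _ => 0.
Proof.
move=> /vert_expand[N h] w0; apply/funext => p; apply/funext => v.
by rewrite (h N) //; apply: big1 => J _; rewrite w0 mul0r.
Qed.

Lemma vert_eq s (w w' : kform s) : vert w -> vert w' ->
  (forall I p, coef w I p = coef w' I p) -> w = w'.
Proof.
move=> wv wv' ww'; have := vert_eq0 (vertB wv wv').
have E I p : coef (fun p v => w p v - w' p v) I p = 0.
  by rewrite -[LHS]/(coef w I p - coef w' I p) ww' subrr.
move=> /(_ E) E'; apply/funext => p; apply/funext => v; apply/eqP; rewrite -subr_eq0.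
by apply/eqP; exact: (congr1 (fun w => w p v) E').
Qed.

Lemma smooth_coef s (w : kform s) I : vert w -> smooth (coef w I).
Proof. by move=> /smooth_vert/(_ (dual_vec I)). Qed.

Lemma coef_bounded s (w : kform s) : vert w ->
  exists m, forall I, (m <= deg I)%N -> coef w I = fun=> 0.
Proof.
elim=> {w} [|w w' _ [m1 h1] _ [m2 h2]|f I fs].
- by exists 0%N.
- exists (maxn m1 m2) => I; rewrite geq_max => /andP[I1 I2]; apply/funext => p.
  by rewrite -[LHS]/(coef w I p + coef w' I p) h1 // h2 // addr0.
exists (deg I).+1 => J IJ; apply/funext => p; rewrite /coef /tens.
under eq_bigr do rewrite /thetas theta_dual_vec.
have [a Ja] : exists a, J a != I a.
  apply/existsP; apply: contraLR IJ => /existsPn E; rewrite -leqNgt.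
  by apply: leq_sum => a _; rewrite leq_eqVlt -[_ == _]negbK E.
by rewrite (bigD1 a) //= eq_sym (negbTE Ja) mul0r mulr0.
Qed.

(** A vertical argument may have infinitely many components, so linearity in it
    has to be expressed through the finitely many that matter. *)
Lemma vert_slot s (w : kform s) : vert w -> exists N0, forall N, (N0 <= N)%N ->
  forall p v a (d : tvec R), d ct = 0 -> d cx = 0 ->
    w p (upd v a d) = \sum_(k < N) d (cu k) * w p (upd v a (fun c => (c == cu k)%:R)).
Proof.
elim=> {w} [|w w' _ [N1 h1] _ [N2 h2]|f I fs].
- by exists 0%N => N _ p v a d _ _; rewrite big1 // => k _; rewrite mulr0.
- exists (maxn N1 N2) => N; rewrite geq_max => /andP[N1N N2N] p v a d dt dx.
  rewrite (h1 N) // (h2 N) // -big_split; apply: eq_bigr => J _.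
  by rewrite mulrDr.
exists (\max_a (I a).+1)%N => N IN p v a d dt dx.
have iN : (I a < N)%N by apply: leq_trans IN; apply: (leq_bigmax a).
rewrite /tens (bigD1 a) //= {1}/upd eqxx /thetas theta_vertical //.
rewrite -(sum_delta (fun k => d (cu k)) iN) mulr_suml mulr_sumr; apply: eq_bigr => k _.
rewrite mulrCA -!mulrA; congr (_ * _); rewrite [in RHS](bigD1 a) //= {2}/upd eqxx mulrCA.
rewrite (theta_vertical (d := fun c => (c == cu k)%:R)) //; congr (_ * (_%:R * _)).
by apply: eq_bigr => b ba; rewrite /upd (negbTE ba).
Qed.

Lemma vert_slot0 s (w : kform s) p v a : vert w -> w p (upd v a (fun=> 0)) = 0.
Proof.
move=> /vert_slot[N h]; rewrite (h N) // big1 // => k _; exact: mul0r.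
Qed.

Lemma upd_dual_vec s (I : 'I_s -> nat) a k :
  upd (dual_vec I) a (fun c => (c == cu k)%:R) = dual_vec (upd I a k).
Proof. by apply/funext => b; rewrite /dual_vec /upd; case: eqP. Qed.

(** Since X has component u_(k+1) along d/du_k, differentiating X along d/du_i gives
    d/du_(i-1).  So X acts as the sum of its action on the coefficients and of the
    multiplication by z_1 + ... + z_s. *)
Lemma coef_lieX s (w : kform s) I p : vert w ->
  coef (lieX w) I p = X (coef w I) p + psum_mul 1 (fun J => coef w J p) I.
Proof.
move=> wv; rewrite {1}/coef /lie; congr (_ + _); apply: eq_bigr => a _.
set d := fun c : jcoord => _.
rewrite -[fun b => _]/(upd (dual_vec I) a d); case: ifPn => [Ia|Ia].
  rewrite (_ : d = fun c => (c == cu (I a - 1))%:R) ?upd_dual_vec //.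
  apply/funext => c; rewrite /d; case: c => [||k]; rewrite ?dirD_cst // dirD_coord /dual_vec.
  by congr (nat_of_bool _)%:R; apply/eqP/eqP => -[] E; congr cu; lia.
rewrite (_ : d = fun=> 0) ?vert_slot0 //.
apply/funext => c; rewrite /d; case: c => [||k]; rewrite ?dirD_cst // dirD_coord /dual_vec.
case: eqP => // -[] E; lia.
Qed.

(** Differentiating T along d/du_i gives the components d(X^k K)/du_i.  These vanish
    for i > n + k and equal dK/du_n for i = n + k, so in the top possible degree
    the only surviving indices are I with one entry lowered by n. *)
Lemma coef_lieT_top s (w : kform s) m I p : vert w -> (0 < n)%N ->
  (forall J, (m < deg J)%N -> coef w J = fun=> 0) -> (m + n <= deg I)%N ->
  coef (lieT w) I p = pd (cu n) K p * psum_mul n (fun J => coef w J p) I.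
Proof.
move=> wv n0 wm mI; rewrite {1}/coef /lie.
rewrite -[fun q => w q (dual_vec I)]/(coef w I) wm ?vfact_cst ?add0r; last by lia.
rewrite mulr_sumr; apply: eq_bigr => a _.
set d := fun c : jcoord => _.
rewrite -[fun b => _]/(upd (dual_vec I) a d).
have [N0 h] := vert_slot wv.
rewrite (h (N0 + (I a).+1)%N) ?leq_addr //; [|exact: dirD_cst|exact: dirD_cst].
have dE k : d (cu k) = pd (cu (I a)) (XK k) p.
  by rewrite /d -[fun q => _]/(XK k) /dual_vec (dirD_unit _ _ (smooth_XK Ks k)).
have w0 k : (I a < n + k)%N -> w p (upd (dual_vec I) a (fun c => (c == cu k)%:R)) = 0.
  move=> kI; rewrite upd_dual_vec -[LHS]/(coef w (upd I a k) p) wm //.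
  by have := deg_upd I a k; lia.
have z k : (I a != n + k)%N ->
    d (cu k) * w p (upd (dual_vec I) a (fun c => (c == cu k)%:R)) = 0.
  move=> kI; have [lt|ge] := ltnP (I a) (n + k)%N; first by rewrite w0 // mulr0.
  by rewrite dE (pd_XK_beyond Kn) ?mul0r //; lia.
case: ifPn => [nI|nI]; last first.
  by rewrite mulr0; apply: big1 => k _; apply: z; lia.
have kN : (I a - n < N0 + (I a).+1)%N by lia.
rewrite (bigD1 (Ordinal kN)) //= dE big1 ?addr0 => [|k].
  rewrite upd_dual_vec; congr (_ * _).
  by have := pd_XK_top Ks Kn (I a - n); rewrite subnKC // => ->.
by rewrite -val_eqE /= => kI; apply: z; move: kI; lia.
Qed.

Lemma vert_of_coef s (C : ('I_s -> nat) -> Rinfty R -> R) m :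
  (forall I, smooth (C I)) -> (forall I, (m <= deg I)%N -> C I = fun=> 0) ->
  exists w, vert w /\ forall I, coef w I = C I.
Proof.
move=> Cs Cm.
exists (fun p v => \sum_(J : {ffun 'I_s -> 'I_m})
    tens (C (fun a => J a)) (thetas (fun a => J a)) p v).
split; first by apply: vert_sum => J; exact: (Vert_tens _ (Cs _)).
move=> I; apply/funext => p; rewrite /coef /tens.
have E (J : {ffun 'I_s -> 'I_m}) : \prod_a thetas (fun a => J a) a p (dual_vec I a) =
    [forall a, J a == I a :> nat]%:R.
  under eq_bigr do rewrite /thetas theta_dual_vec.
  case: forallP => [h|/forallP/forallPn[a Ja]]; first by rewrite big1 // => a _; rewrite h.
  by rewrite (bigD1 a) //= (negbTE Ja) mul0r.
under eq_bigr do rewrite E.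
case: (boolP [forall a, (I a < m)%N]) => [/forallP Im|/forallPn[a Ia]].
  rewrite (bigD1 [ffun a => Ordinal (Im a)]) //= big1 ?addr0 => [|J JI].
    case: forallP => [_|[]]; last by move=> a; rewrite ffunE.
    by rewrite mulr1; congr C; apply/funext => a; rewrite ffunE.
  case: forallP => [h|_]; last by rewrite mulr0.
  case/eqP: JI; apply/ffunP => a; rewrite ffunE; apply/val_inj; exact/eqP/h.
rewrite Cm; last first.
  by rewrite -leqNgt in Ia; apply: leq_trans Ia _; rewrite /deg (bigD1 a) //= leq_addr.
apply: big1 => J _; case: forallP => [/(_ a)/eqP E'|_]; last by rewrite mulr0.
by case/negP: Ia; rewrite -E'.
Qed.

End Vertical.

(** * Exactness in the vertical direction *)
Section Core.
Variables (R : realType) (n : nat) (K : Rinfty R -> R).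
Hypotheses (Ks : smooth K) (Kn : depends_upto n K).
Implicit Types (f g : Rinfty R -> R) (p q : Rinfty R).

Local Notation X := (vfact (@Xvf R)).
Local Notation lieX := (lie (@Xvf R)).
Local Notation lieT := (lie (Tvf K)).
Local Notation vert := (vert K).

Lemma psum_mul_homog s k D (c : ('I_s -> nat) -> R) I :
  psum_mul k (fun J => if deg J == D then c J else 0) I =
  if deg I == (D + k)%N then psum_mul k c I else 0.
Proof.
rewrite /psum_mul; case: ifPn => dI.
  apply: eq_bigr => a _; case: ifPn => // Ia; have := deg_shift Ia.
  by rewrite (eqP dI) => /addIn ->; rewrite eqxx.
apply: big1 => a _; case: ifPn => // Ia; have := deg_shift Ia.
by case: eqP => // -> E; rewrite E eqxx in dI.
Qed.

Lemma psum_mul_top0 s k D (c : ('I_s -> nat) -> R) I :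
  (forall J, (D < deg J)%N -> c J = 0) -> (D + k < deg I)%N -> psum_mul k c I = 0.
Proof.
move=> cD dI; apply: big1 => a _; case: ifPn => // Ia; apply: cD.
by have := deg_shift Ia; lia.
Qed.

(** Going down from a bound on the degree of [w], in each degree X acts as
    multiplication by z_1 + ... + z_s, which is injective. *)
Lemma top_vanish s (w : kform s) M : (2 < s)%N -> vert w ->
  (forall I, (M < deg I)%N -> coef (lieX w) I = fun=> 0) ->
  forall I, (M <= deg I)%N -> coef w I = fun=> 0.
Proof.
move=> s3 wv Xw; have [B wB] := coef_bounded wv.
suff H j I : (M <= deg I)%N -> (B <= deg I + j)%N -> coef w I = fun=> 0.
  by move=> I MI; apply: (H B) => //; apply: leq_addl.
elim: j I => [|j IH] I MI BI; first by apply: wB; rewrite addn0 in BI.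
have [lt|ge] := leqP B (deg I + j); first exact: IH.
apply/funext => p; pose D := deg I.
pose b J := if deg J == D then coef w J p else 0.
have -> : coef w I p = b I by rewrite /b eqxx.
apply: (@PowerSums.psum_mul1_inj _ _ b D) => // J.
  by rewrite /b; case: eqP => // ->; rewrite ltnn.
rewrite psum_mul_homog; case: eqP => // dJ.
have : coef (lieX w) J p = 0 by rewrite Xw // dJ /D; lia.
rewrite (coef_lieX _ _ wv) IH ?vfact_cst ?add0r // dJ /D; lia.
Qed.

Lemma lieX_inj s (w w' : kform s) : (2 < s)%N -> vert w -> vert w' ->
  lieX w = lieX w' -> w = w'.
Proof.
move=> s3 wv wv' ww'; apply: (vert_eq wv wv') => I p.
have Ew : lieX (fun p v => w p v + -1 * w' p v) = fun _ _ => 0.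
  have w's := smooth_vert Ks wv'.
  rewrite (lieD _ (smooth_vert Ks wv) (smooth_vert Ks (vertZ (-1) wv'))) lieZ // ww'.
  by apply/funext => q; apply/funext => v; rewrite mulN1r subrr.
have := @top_vanish s _ 0 s3 (VertD wv (vertZ (-1) wv')).
rewrite Ew => /(_ (fun _ _ => erefl) I (leq0n _))/(congr1 (@^~ p)).
by rewrite coef_formD {2}/coef mulN1r => /eqP; rewrite subr_eq0 => /eqP.
Qed.

(** The quotient is found separately at each point.  It is smooth because the
    equation A_(I + e) = C_I + sum_(b != a0) C_(I + e - e_b), with e = e_a0, determines
    C_I from A and from values of C at indices whose entry at [a0] is larger; that
    entry is bounded since C is homogeneous. *)
Lemma quotient_smooth s (A C : ('I_s -> nat) -> Rinfty R -> R) m (a0 : 'I_s) :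
  (forall I p, (deg I).+1 != m -> C I p = 0) ->
  (forall I, smooth (A I)) ->
  (forall I p, A I p = psum_mul 1 (fun J => C J p) I) ->
  forall I, smooth (C I).
Proof.
move=> Cm As AC.
suff H k I : (m - I a0 <= k)%N -> smooth (C I) by move=> I; apply: (H (m - I a0)%N).
elim: k I => [|k IH] I Ik; have [dI|dI] := eqVneq (deg I).+1 m.
- have : (I a0 <= deg I)%N by rewrite /deg (bigD1 a0) //= leq_addr.
  by lia.
- by rewrite (_ : C I = fun=> 0); [exact: smooth_cst|apply/funext => p; apply: Cm].
- pose I' := upd I a0 (I a0).+1.
  have I'a : I' a0 = (I a0).+1 by rewrite /I' /upd eqxx.
  have -> : C I = fun p => A I' p -
      \sum_(b | b != a0) (if (1 <= I' b)%N then C (upd I' b (I' b - 1)%N) else fun=> 0) p.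
    apply/funext => p; rewrite AC /psum_mul (bigD1 a0) //= I'a subn1 /=.
    rewrite (_ : upd I' a0 (I a0) = I).
      apply/esym/eqP; rewrite subr_eq; apply/eqP; congr (_ + _).
      by apply: eq_bigr => b _; case: ifP.
    by apply/funext => b; rewrite /I' /upd; case: eqP => [->|].
  apply: smoothB (As I') _; apply: smooth_sum => b ba.
  case: ifP => _; last exact: smooth_cst.
  apply: IH; rewrite {1}/upd eq_sym (negbTE ba) I'a; lia.
- by rewrite (_ : C I = fun=> 0); [exact: smooth_cst|apply/funext => p; apply: Cm].
Qed.

Lemma lieB V s (w w' : kform s) : vert w -> vert w' ->
  lie V (fun p v => w p v - w' p v) = fun p v => lie V w p v - lie V w' p v.
Proof.
move=> wv wv'; rewrite (_ : (fun _ _ => _) = fun p v => w p v + -1 * w' p v).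
  rewrite (lieD _ (smooth_vert Ks wv) (smooth_vert Ks (vertZ (-1) wv'))).
  rewrite (lieZ _ _ (smooth_vert Ks wv')).
  by apply/funext => p; apply/funext => v; rewrite mulN1r.
by apply/funext => p; apply/funext => v; rewrite mulN1r.
Qed.

Hypothesis (n2 : (1 < n)%N) (K_sep : forall p, pd (cu n) K p <> 0).

(** The leading part of [alpha] is a multiple of z_1 + ... + z_s, hence agrees with
    that of X of some tensor. *)
Lemma peel_top s (alpha beta : kform s) m : (2 < s)%N -> vert alpha -> vert beta ->
  (forall I, (m < deg I)%N -> coef alpha I = fun=> 0) ->
  lieX beta = lieT alpha ->
  exists gamma, vert gamma /\ forall I, (m <= deg I)%N -> coef (lieX gamma) I = coef alpha I.
Proof.
move=> s3 av bv am ba.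
have Ta I p : (m + n <= deg I)%N ->
    coef (lieX beta) I p = pd (cu n) K p * psum_mul n (fun J => coef alpha J p) I.
  by move=> dI; rewrite ba (coef_lieT_top Ks Kn p av (ltnW n2) am).
have bm I : (m + n <= deg I)%N -> coef beta I = fun=> 0.
  apply: (top_vanish s3 bv) => J dJ; apply/funext => p.
  rewrite Ta ?(psum_mul_top0 (D := m)) ?mulr0 //.
    by move=> L dL; rewrite am.
  exact: ltnW.
have quot p : exists c : ('I_s -> nat) -> R, (forall I, (deg I).+1 != m -> c I = 0) /\
    forall I, (if deg I == m then coef alpha I p else 0) = psum_mul 1 c I.
  (* The leading parts at [p]: degree m for alpha, degree m + n - 1 for beta. *)
  pose b J := if deg J == (m + n).-1 then coef beta J p else 0.
  apply: (@PowerSums.psum_mul_divide R s m n (pd (cu n) K p) _ b) => //.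
  - exact/eqP/K_sep.
  - by move=> I /negbTE ->.
  - by move=> I dI; rewrite /b; case: eqP => // E; case/eqP: dI; lia.
  move=> I; rewrite !psum_mul_homog.
  have -> : ((m + n).-1 + 1 = m + n)%N by lia.
  case: eqP => [dI|_]; last by rewrite mulr0.
  rewrite -Ta ?dI // (coef_lieX _ _ bv) bm ?dI // vfact_cst add0r //.
have [c cP] := choice quot.
pose C (I : 'I_s -> nat) p := c p I.
have Cm I p : (deg I).+1 != m -> C I p = 0 by move=> dI; apply: (cP p).1.
have aC I p : (if deg I == m then coef alpha I p else 0) = psum_mul 1 (fun J => C J p) I.
  exact: (cP p).2.
have Cs : forall I, smooth (C I).
  apply: (@quotient_smooth s (fun I => if deg I == m then coef alpha I else fun=> 0) C m
           (Ordinal (ltnW (ltnW s3))) Cm).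
    by move=> I; case: ifP => _; [exact: (smooth_coef Ks _ av)|exact: smooth_cst].
  by move=> I p; rewrite -aC; case: ifP.
have C0 I : (m <= deg I)%N -> C I = fun=> 0.
  by move=> dI; apply/funext => p; apply: Cm; lia.
have [gamma [gv gC]] := vert_of_coef K Cs C0.
exists gamma; split=> // I dI; apply/funext => p.
rewrite (coef_lieX _ _ gv) gC C0 // vfact_cst add0r.
have -> : (fun J => coef gamma J p) = (fun J => C J p) by apply/funext => J; rewrite gC.
rewrite -aC; case: eqP => // dm; rewrite am //; lia.
Qed.

(** Subtracting X g1, and T g1 from [beta], preserves X beta = T alpha as X and T
    commute, and lowers the degree of [alpha]. *)
Lemma vertical_poincare_deg s : (2 < s)%N -> forall m (alpha beta : kform s),
  vert alpha -> vert beta ->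
  (forall I, (m <= deg I)%N -> coef alpha I = fun=> 0) ->
  lieX beta = lieT alpha -> exists gamma, vert gamma /\ lieX gamma = alpha.
Proof.
move=> s3; elim=> [|m IH] alpha beta av bv am ba.
  exists (fun _ _ => 0); split; first exact: Vert0.
  rewrite lie0; apply/esym; apply: (vert_eq0 av) => I p; rewrite am //.
have [g1 [g1v g1P]] := peel_top s3 av bv am ba.
have Xg := vert_lieX Ks g1v; have Tg := vert_lieT Ks Kn g1v.
have [||I dI||g2 [g2v g2P]] := IH (fun p v => alpha p v - lieX g1 p v)
    (fun p v => beta p v - lieT g1 p v).
- exact: (vertB av Xg).
- exact: (vertB bv Tg).
- apply/funext => p; rewrite -[LHS]/(coef alpha I p - coef (lieX g1) I p) g1P //.
  exact: subrr.
- by rewrite (lieB _ bv Tg) (lieB _ av Xg) ba (lie_XT Ks Kn g1v).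
exists (fun p v => g2 p v + g1 p v); split; first exact: VertD.
rewrite (lieD _ (smooth_vert Ks g2v) (smooth_vert Ks g1v)) g2P.
by apply/funext => p; apply/funext => v; rewrite subrK.
Qed.

Lemma vertical_poincare s (alpha beta : kform s) : (2 < s)%N -> vert alpha -> vert beta ->
  lieX beta = lieT alpha -> exists gamma, vert gamma /\ lieX gamma = alpha.
Proof.
move=> s3 av bv; have [m am] := coef_bounded av.
exact: (vertical_poincare_deg s3 av bv am).
Qed.

End Core.

(** * Alternation, and forms of type (0,s) *)
Section Alternation.
Variables (R : realType) (n : nat) (K : Rinfty R -> R).
Hypotheses (Ks : smooth K) (Kn : depends_upto n K).
Implicit Types (f g : Rinfty R -> R) (p q : Rinfty R).

Local Notation vert := (vert K).
Local Notation thetas I := (thetas K I).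
Local Notation Omega r s := (@Omega R K r s).

Definition permute s (sigma : 'S_s) (w : @kform R s) : kform s :=
  fun p v => w p (fun a => v (sigma a)).

Definition alternating s (w : @kform R s) :=
  forall (sigma : 'S_s) p v, permute sigma w p v = (-1) ^+ sigma * w p v.

Definition alternate s (w : @kform R s) : kform s :=
  fun p v => s`!%:R^-1 * \sum_(sigma : 'S_s) (-1) ^+ sigma * permute sigma w p v.

Lemma alternate_id s (w : kform s) : alternating w -> alternate w = w.
Proof.
move=> wa; apply/funext => p; apply/funext => v; rewrite /alternate.
under eq_bigr do rewrite wa mulrA -expr2 sqrr_sign mul1r.
rewrite sumr_const (_ : #|_| = s`!); last by rewrite -card_Sn; apply: eq_card.
by rewrite -[X in _ * X]mulr_natl mulrA mulVf ?mul1r // pnatr_eq0 -lt0n fact_gt0.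
Qed.

Lemma permute_tens s (sigma : 'S_s) f (phi : 'I_s -> oneform) :
  permute sigma (tens f phi) = tens f (fun a => phi ((sigma^-1)%g a)).
Proof.
apply/funext => p; apply/funext => v; rewrite /permute /tens; congr (_ * _).
by rewrite [RHS](reindex_inj (@perm_inj _ sigma)); apply: eq_bigr => a _ /=; rewrite permK.
Qed.

Lemma vert_permute s (sigma : 'S_s) (w : kform s) : vert w -> vert (permute sigma w).
Proof.
elim=> {w} [|w w' _ wv _ wv'|f I fs]; first exact: Vert0.
- exact: VertD wv wv'.
- by rewrite permute_tens; exact: (Vert_tens _ _ fs).
Qed.

Lemma vert_alternate s (w : kform s) : vert w -> vert (alternate w).
Proof.
move=> wv; apply: vertZ; apply: vert_sum => sigma.
exact/vertZ/vert_permute.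
Qed.

(** The permutation reindexes the sum over the replaced argument. *)
Lemma lie_permute V s (sigma : 'S_s) (w : kform s) :
  lie V (permute sigma w) = permute sigma (lie V w).
Proof.
apply/funext => p; apply/funext => v; rewrite /lie /permute; congr (_ + _).
rewrite (reindex_inj (@perm_inj _ sigma)); apply: eq_bigr => a _ /=.
by congr (w p _); apply/funext => b; rewrite (inj_eq (@perm_inj _ sigma)).
Qed.

Lemma lie_alternate V s (w : kform s) : vert w ->
  lie V (alternate w) = alternate (lie V w).
Proof.
move=> wv; have ps sigma := smooth_vert Ks (vert_permute sigma wv).
have Zs sigma := smooth_vert Ks (vertZ ((-1) ^+ odd_perm sigma) (vert_permute sigma wv)).
rewrite /alternate (lieZ V _ (smooth_kform_sum _ Zs)) (lie_sum V _ Zs).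
apply/funext => p; apply/funext => v; congr (_ * _); apply: eq_bigr => sigma _.
by rewrite (lieZ V _ (ps sigma)) lie_permute.
Qed.

Lemma wedge1s_tens s (phi : 'I_s -> @oneform R) f p v :
  f p * wedge1s phi p v = \sum_(sigma : 'S_s) (-1) ^+ sigma * permute sigma (tens f phi) p v.
Proof.
rewrite /wedge1s /determinant mulr_sumr; apply: eq_bigr => sigma _.
rewrite mulrCA /permute /tens; congr (_ * (_ * _)).
by apply: eq_bigr => a _; rewrite mxE.
Qed.

Lemma basic0E s (h : 'I_0 -> bool) (I : 'I_s -> nat) : basic K h I = wedge1s (thetas I).
Proof.
rewrite /basic; congr wedge1s; apply/funext => a.
by case: split_ordP => [[]//|b ->]; congr (thetas I); apply/val_inj.
Qed.

Lemma split_lift0 s (b : 'I_s) : fintype.split (lift ord0 b : 'I_(1 + s)) = inr b.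
Proof.
have -> : lift ord0 b = rshift 1 b :> 'I_(1 + s) by apply: val_inj.
exact: (unsplitK (inr b)).
Qed.

(** Laplace expansion along the row of the horizontal covector. *)
Lemma basic1E s (h : 'I_1 -> bool) (I : 'I_s -> nat) :
  basic K h I = wedgel (dcoord (if h ord0 then ct else cx)) (wedge1s (thetas I)).
Proof.
apply/funext => p; apply/funext => v; rewrite /basic {1}/wedge1s.
rewrite (expand_det_row _ (ord0 : 'I_(1 + s))) /wedgel; apply: eq_bigr => b _.
rewrite mxE /cofactor add0n mulrCA mulrA; congr (_ * _ * _).
  case: split_ordP => [a ea|a /(congr1 val)]; last by [].
  by rewrite ord1.
rewrite /wedge1s; congr determinant; apply/matrixP => i j; rewrite !mxE.
by rewrite split_lift0.
Qed.

Lemma Omega_ext r s (w : kform (r + s)) J (f : 'I_J -> Rinfty R -> R) h i :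
  (forall j, smooth (f j)) ->
  (forall p v, w p v = \sum_(j < J) f j p * basic K (h j) (i j) p v) -> Omega r s w.
Proof.
move=> fs wE; exists J, f, h, i; split=> //.
by apply/funext => p; apply/funext => v.
Qed.

Lemma Omega0 r s : Omega r s (fun _ _ => 0).
Proof.
apply: (@Omega_ext r s _ 0 (fun _ _ => 0) (fun _ _ => true) (fun _ _ => 0%N)) => [[j j0]|p v].
  by exfalso; move: j0; rewrite ltn0.
by rewrite big_ord0.
Qed.

Lemma OmegaD r s (w w' : kform (r + s)) : Omega r s w -> Omega r s w' ->
  Omega r s (fun p v => w p v + w' p v).
Proof.
move=> [m [f [h [i [fs ->]]]]] [m' [f' [h' [i' [fs' ->]]]]].
pose glue T (x : 'I_m -> T) (y : 'I_m' -> T) j :=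
  match fintype.split j with inl a => x a | inr b => y b end.
apply: (@Omega_ext r s _ (m + m') (glue _ f f') (glue _ h h') (glue _ i i')).
  by move=> j; rewrite /glue; case: (fintype.split j).
move=> p v; rewrite big_split_ord /glue; congr (_ + _); apply: eq_bigr => j _.
  by rewrite (unsplitK (inl j)).
by rewrite (unsplitK (inr j)).
Qed.

Lemma OmegaZ r s (a : R) (w : kform (r + s)) : Omega r s w ->
  Omega r s (fun p v => a * w p v).
Proof.
move=> [m [f [h [i [fs ->]]]]].
apply: (@Omega_ext r s _ m (fun j p => a * f j p) h i) => [j|p v].
  exact: (smoothZ a (fs j)).
by rewrite mulr_sumr; apply: eq_bigr => j _; rewrite mulrA.
Qed.

Lemma alternate_Omega s (w : kform s) : vert w -> Omega 0 s (alternate w).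
Proof.
elim=> {w} [|w w' _ wO _ wO'|f I fs].
- rewrite (_ : alternate _ = fun _ _ => 0); first exact: Omega0.
  apply/funext => p; apply/funext => v; rewrite /alternate big1 ?mulr0 // => sigma _.
  exact: mulr0.
- rewrite (_ : alternate _ = fun p v => alternate w p v + alternate w' p v).
    exact: (@OmegaD 0 s _ _ wO wO').
  apply/funext => p; apply/funext => v; rewrite /alternate -mulrDr -big_split /=.
  by congr (_ * _); apply: eq_bigr => sigma _; rewrite -mulrDr.
apply: (@Omega_ext 0 s _ 1 (fun _ p => s`!%:R^-1 * f p) (fun _ _ => true) (fun _ => I)).
  by move=> _; exact: (smoothZ _ fs).
by move=> p v; rewrite big_ord1 basic0E -mulrA wedge1s_tens.
Qed.

Lemma Omega_vert s (w : kform s) : Omega 0 s w -> vert w.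
Proof.
move=> [m [f [h [i [fs ->]]]]]; apply: vert_sum => j.
rewrite (_ : (fun p v => _) = fun p v => \sum_(sigma : 'S_s)
    (-1) ^+ sigma * permute sigma (tens (f j) (thetas (i j))) p v).
  by apply: vert_sum => sigma; apply/vertZ/vert_permute; exact: (Vert_tens _ _ (fs j)).
by apply/funext => p; apply/funext => v; rewrite basic0E wedge1s_tens.
Qed.

Lemma Omega_alternating s (w : kform s) : Omega 0 s w -> alternating w.
Proof.
move=> [m [f [h [i [_ ->]]]]] sigma p v; rewrite /permute mulr_sumr.
apply: eq_bigr => j _; rewrite !basic0E [RHS]mulrCA; congr (_ * _).
rewrite /wedge1s.
rewrite (_ : \matrix_(a, b) _ = col_perm sigma (\matrix_(a, b) thetas (i j) a p (v b))).
  by rewrite col_permE det_mulmx det_perm odd_permV mulrC.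
by apply/matrixP => a b; rewrite !mxE.
Qed.

End Alternation.

(** * Forms of type (1,s) *)
Section Horizontal.
Variables (R : realType) (n : nat) (K : Rinfty R -> R).
Hypotheses (Ks : smooth K) (Kn : depends_upto n K).
Implicit Types (f g : Rinfty R -> R) (p q : Rinfty R).

Local Notation vert := (vert K).
Local Notation thetas I := (thetas K I).
Local Notation lieX := (lie (@Xvf R)).
Local Notation lieT := (lie (Tvf K)).
Local Notation Omega r s := (@Omega R K r s).

Definition hor s (alpha beta : @kform R s) : @kform R s.+1 := fun p v =>
  wedgel (dcoord cx) alpha p v + wedgel (dcoord ct) beta p v.

Lemma dHE s (w : kform s) : dH K w = hor (lieX w) (lieT w).
Proof. by []. Qed.

Lemma wedgel_sum s (phi : oneform) m (w : 'I_m -> @kform R s) p v :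
  wedgel phi (fun p v => \sum_(j < m) w j p v) p v = \sum_(j < m) wedgel phi (w j) p v.
Proof.
rewrite /wedgel exchange_big; apply: eq_bigr => a _.
by rewrite mulr_sumr.
Qed.

Lemma Omega1_hor s (w : kform s.+1) : Omega 1 s w ->
  exists alpha beta, [/\ Omega 0 s alpha, Omega 0 s beta & w = hor alpha beta].
Proof.
move=> [m [f [h [i [fs wE]]]]].
pose part (b : bool) : kform s := fun p v =>
  \sum_(j < m) (if h j ord0 == b then f j p else 0) * wedge1s (thetas (i j)) p v.
have partO b : Omega 0 s (part b).
  apply: (@Omega_ext R K 0 s _ m (fun j p => if h j ord0 == b then f j p else 0)
            (fun _ _ => true) i) => [j|p v].
    by case: eqP => _; [exact: fs|exact: smooth_cst].
  by apply: eq_bigr => j _; rewrite basic0E.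
exists (part false), (part true); split=> //.
rewrite wE; apply/funext => p; apply/funext => v.
rewrite /hor /part !wedgel_sum -big_split; apply: eq_bigr => j _.
rewrite basic1E /wedgel mulr_sumr -big_split; apply: eq_bigr => a _ /=.
by case: (h j ord0) => /=; rewrite !mul0r mulr0 ?addr0 ?add0r mulrCA.
Qed.

Definition vcons s (v0 : tvec R) (v : 'I_s -> tvec R) : 'I_s.+1 -> tvec R :=
  fun a => if unlift ord0 a is Some b then v b else v0.

Lemma vcons0 s v0 (v : 'I_s -> tvec R) : vcons v0 v ord0 = v0.
Proof. by rewrite /vcons unlift_none. Qed.

Lemma vconsS s v0 (v : 'I_s -> tvec R) b : vcons v0 v (lift ord0 b) = v b.
Proof. by rewrite /vcons liftK. Qed.

Lemma vcons_eta s (v : 'I_s.+1 -> tvec R) : v = vcons (v ord0) (fun b => v (lift ord0 b)).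
Proof. by apply/funext => a; rewrite /vcons; case: unliftP => [b ->|->]. Qed.

Definition vertical (v : tvec R) := v ct = 0 /\ v cx = 0.

Lemma vertical_dual_vec s (I : 'I_s -> nat) a : vertical (dual_vec R I a).
Proof. by []. Qed.

Lemma wedgel_vcons s c (w : @kform R s) p v0 v :
  (forall a, v a c = 0) ->
  wedgel (dcoord c) w p (vcons v0 v) = v0 c * w p v.
Proof.
move=> vc; rewrite /wedgel big_ord_recl big1 ?addr0 => [|a _].
  rewrite expr0 mul1r /dcoord vcons0; congr (_ * w p _).
  by apply/funext => b; rewrite vconsS.
by rewrite /dcoord vconsS vc mulr0 mul0r.
Qed.

Lemma hor_vcons s (alpha beta : @kform R s) p v0 v : (forall a, vertical (v a)) ->
  hor alpha beta p (vcons v0 v) = v0 cx * alpha p v + v0 ct * beta p v.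
Proof. by move=> vv; rewrite /hor !wedgel_vcons // => a; have [] := vv a. Qed.

(** The components of V along d/dt and d/dx are constant, so that brackets with
    constant fields are vertical. *)
Definition flat_hor (V : @vfield R) :=
  forall v p, vertical (fun c => dirD v (fun q => V q c) p).

Lemma flat_X : flat_hor (@Xvf R).
Proof. by move=> v p; split; exact: dirD_cst. Qed.

Lemma flat_T : flat_hor (Tvf K).
Proof. by move=> v p; split; exact: dirD_cst. Qed.

Lemma lie_hor V s (alpha beta : kform s) p v0 I : flat_hor V ->
  smooth_kform alpha -> smooth_kform beta ->
  lie V (hor alpha beta) p (vcons v0 (dual_vec R I)) =
  v0 cx * lie V alpha p (dual_vec R I) + v0 ct * lie V beta p (dual_vec R I).
Proof.
move=> Vf als bes; have vv := vertical_dual_vec I.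
rewrite /lie (_ : (fun q => hor alpha beta q _) =
    fun q => v0 cx * alpha q (dual_vec R I) + v0 ct * beta q (dual_vec R I)); last first.
  by apply/funext => q; rewrite hor_vcons.
have as' := als (dual_vec R I); have bs' := bes (dual_vec R I).
rewrite (vfactD V (smoothZ (v0 cx) as') (smoothZ (v0 ct) bs')).
rewrite (vfactZ V _ as') (vfactZ V _ bs') big_ord_recl /=.
set D := fun v c => dirD v (fun q => V q c) p.
have -> : hor alpha beta p (fun b => if b == ord0 then D (vcons v0 (dual_vec R I) ord0)
    else vcons v0 (dual_vec R I) b) = 0.
  rewrite [X in hor _ _ _ X]vcons_eta /= hor_vcons => [|b]; last by rewrite vconsS.
  have [D0 D1] : vertical (D (vcons v0 (dual_vec R I) ord0)) := Vf _ p.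
  by rewrite D0 D1 !mul0r addr0.
have E a : hor alpha beta p (fun b => if b == lift ord0 a then
      D (vcons v0 (dual_vec R I) (lift ord0 a)) else vcons v0 (dual_vec R I) b) =
    v0 cx * alpha p (fun b => if b == a then D (dual_vec R I a) else dual_vec R I b) +
    v0 ct * beta p (fun b => if b == a then D (dual_vec R I a) else dual_vec R I b).
  rewrite -hor_vcons => [|b]; last by case: eqP => _ //; exact: Vf.
  congr (hor _ _ _ _); apply/funext => b; rewrite vconsS.
  case: (unliftP ord0 b) => [c ->|->]; last by rewrite !vcons0.
  by rewrite !vconsS (inj_eq (@lift_inj _ ord0)).
under eq_bigr do rewrite E.
rewrite big_split /= -!mulr_sumr add0r !mulrDr; exact: addrACA.
Qed.

(** Evaluating d_H (dx /\ alpha + dt /\ beta) on d/dx, d/dt and vertical vectors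
    isolates the component along dx /\ dt, which is X beta - T alpha. *)
Lemma coef_dH_hor s (alpha beta : kform s) I p :
  smooth_kform alpha -> smooth_kform beta ->
  dH K (hor alpha beta) p
    (vcons (fun c => (c == cx)%:R) (vcons (fun c => (c == ct)%:R) (dual_vec R I))) =
  coef (lieX beta) I p - coef (lieT alpha) I p.
Proof.
move=> als bes; rewrite dHE /hor /wedgel !big_ord_recl /=.
rewrite !big1 => [|a _|a _]; last 2 first.
- by rewrite /dcoord vconsS vconsS /dual_vec mulr0 mul0r.
- by rewrite /dcoord vconsS vconsS /dual_vec mulr0 mul0r.
rewrite /dcoord !vcons0 !vconsS !vcons0 /= !mulr0 !mul0r !addr0 !add0r.
rewrite expr0 expr1 !mulr1 mul1r mulN1r.
have -> : (fun b => vcons (fun c => (c == cx)%:R)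
   (vcons (fun c => (c == ct)%:R) (dual_vec R I)) (lift ord0 b)) =
   vcons (fun c => (c == ct)%:R) (dual_vec R I) by apply/funext => b; rewrite vconsS.
have -> : (fun b => vcons (fun c => (c == cx)%:R)
   (vcons (fun c => (c == ct)%:R) (dual_vec R I)) (lift (lift ord0 ord0) b)) =
   vcons (fun c => (c == cx)%:R) (dual_vec R I).
  apply/funext => b; case: (unliftP ord0 b) => [c ->|->].
    rewrite (_ : lift _ _ = lift ord0 (lift ord0 c)) ?vconsS //.
    exact: val_inj.
  by rewrite (_ : lift _ _ = ord0) ?vcons0 //; apply: val_inj.
rewrite (lie_hor _ _ _ (@flat_X) als bes) (lie_hor _ _ _ (@flat_T) als bes) /=.
by rewrite !mul0r !mul1r add0r addr0.
Qed.

(** The primitive of [alpha] under X is made alternating; it is then one of [beta]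
    under T by injectivity of X. *)
Lemma cocycle_exact s (w : kform s.+1) : (1 < n)%N ->
  (forall p, pd (cu n) K p <> 0) -> (2 < s)%N ->
  Omega 1 s w -> dH K w = (fun _ _ => 0) ->
  exists2 gamma, Omega 0 s gamma & dH K gamma = w.
Proof.
move=> n2 Ksep s3 /Omega1_hor[alpha [beta [aO bO ->]]] dw.
have av := Omega_vert aO; have bv := Omega_vert bO.
have als := smooth_vert Ks av; have bes := smooth_vert Ks bv.
have ba : lieX beta = lieT alpha.
  apply: (vert_eq (vert_lieX Ks bv) (vert_lieT Ks Kn av)) => I p.
  by apply/eqP; rewrite -subr_eq0 -(coef_dH_hor _ _ als bes) dw.
have [g [gv gP]] := vertical_poincare Ks Kn n2 Ksep s3 av bv ba.
have gav := vert_alternate gv.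
have Xg : lieX (alternate g) = alpha.
  by rewrite (lie_alternate Ks _ gv) gP (alternate_id (Omega_alternating aO)).
have Tg : lieT (alternate g) = beta.
  apply: (lieX_inj Ks s3 (vert_lieT Ks Kn gav) bv).
  by rewrite (lie_XT Ks Kn gav) Xg ba.
by exists (alternate g); [exact: alternate_Omega|rewrite dHE Xg Tg].
Qed.

Lemma dH_add s (w w' : kform s) : Omega 0 s w -> Omega 0 s w' ->
  dH K (fun p v => w p v + w' p v) = fun p v => dH K w p v + dH K w' p v.
Proof.
move=> /Omega_vert/(smooth_vert Ks) ws /Omega_vert/(smooth_vert Ks) w's.
apply/funext => p; apply/funext => v.
rewrite !dHE /hor (lieD _ ws w's) (lieD _ ws w's).
rewrite addrACA; congr (_ + _); rewrite /wedgel -big_split; apply: eq_bigr => a _;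
  exact: mulrDr.
Qed.

Lemma dHZ s (a : R) (w : kform s) : Omega 0 s w ->
  dH K (fun p v => a * w p v) = fun p v => a * dH K w p v.
Proof.
move=> /Omega_vert/(smooth_vert Ks) ws; apply/funext => p; apply/funext => v.
rewrite !dHE /hor !(lieZ _ _ ws) mulrDr /wedgel !mulr_sumr.
by congr (_ + _); apply: eq_bigr => b _; rewrite mulrCA.
Qed.

End Horizontal.

Theorem theorem3p2 (R : realType) (n : nat) (K : Rinfty R -> R) (s : nat)
  (n_ge2 : (2 <= n)%N)
  (K_order : depends_upto n K) (K_smooth : smooth K)
  (K_sep : forall p : Rinfty R, pd (cu n) K p <> 0)
  (s_ge3 : (3 <= s)%N) :
  cohomology_eq0 K 1 s.
Proof.
have zero_cob : @coboundaries R K 1 s (fun _ _ => 0).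
  exists (fun _ _ => 0); first exact: Omega0.
  rewrite dHE !lie0; apply/funext => p; apply/funext => v.
  by rewrite /hor /wedgel !big1 ?addr0 // => a _; rewrite mulr0.
have cobD w w' : @coboundaries R K 1 s w -> @coboundaries R K 1 s w' ->
    @coboundaries R K 1 s (fun p v => w p v + w' p v).
  move=> [g gO <-] [g' g'O <-]; exists (fun p v => g p v + g' p v).
    exact: (@OmegaD R K 0 s).
  exact: dH_add.
have cobN w : @coboundaries R K 1 s w -> @coboundaries R K 1 s (fun p v => -1 * w p v).
  move=> [g gO <-]; exists (fun p v => -1 * g p v); last exact: dHZ.
  exact: (@OmegaZ R K 0 s).
apply/seteqP; split=> [_ [w [wO dw] <-]|_ ->]; last first.
  exists (fun _ _ => 0) => //; split; first exact: Omega0.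
  rewrite dHE !lie0; apply/funext => p; apply/funext => v.
  by rewrite /hor /wedgel !big1 ?addr0 // => a _; rewrite mulr0.
have [g gO gw] := cocycle_exact K_smooth K_order n_ge2 K_sep s_ge3 wO dw.
(* Coboundaries form a group, so the coset of a coboundary is that of 0. *)
have wcob : @coboundaries R K 1 s w by exists g.
apply/seteqP; split=> _ [c cc <-].
  exists (fun p v => w p v + c p v); first exact: cobD.
  by apply/funext => p; apply/funext => v; rewrite add0r.
exists (fun p v => c p v + -1 * w p v); first exact/cobD/cobN.
by apply/funext => p; apply/funext => v; rewrite add0r mulN1r addrC subrK.
Qed.
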